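(* Let $0<|q|<1$, $0<|p|<1$, $|x|<1$, $|y|<1$. (I) Let $a,b,c,d\in\mathbb{C}$ with $p^{c}\neq p^{-n}$ and $q^{d}\ne q^{-n}$ for all integers $n\ge 0$. Then $$\Psi_{1}(q^{a},p^{b};p^{c},q^{d};q,p,x,y)=\frac{1}{(x;q)_{\infty}}\sum_{\ell=0}^{\infty}\frac{(q^{a};q)_{\ell}(p^{b};p)_{\ell}}{(p^{c};p)_{\ell}(p;p)_{\ell}}y^{\ell}\;{}_{1}\phi_{1}(q^{d-a-\ell};q^{d};q,xq^{a+\ell})$$ and $$\Psi_{1}(q^{a},p^{b};p^{c},q^{d};q,p,x,y)=\frac{1}{(q^{d};q)_{\infty}(x;q)_{\infty}}\sum_{\ell=0}^{\infty}\frac{(q^{a};q)_{\ell}(p^{b};p)_{\ell}}{(p^{c};p)_{\ell}(p;p)_{\ell}}(xq^{a+\ell};q)_{\infty}\,y^{\ell}\;{}_{1}\phi_{1}(x;xq^{a+\ell};q,q^{d}).$$ (II) Let $a,b,c\in\mathbb{C}$ with $p^{b}\neq p^{-n}$ and $q^{c}\ne q^{-n}$ for all integers $n\ge 0$. Then $$\Psi_{2}(q^{a};p^{b},q^{c};q,p,x,y)=\frac{1}{(x;q)_{\infty}}\sum_{\ell=0}^{\infty}\frac{(q^{a};q)_{\ell}}{(p^{b};p)_{\ell}(p;p)_{\ell}}y^{\ell}\;{}_{1}\phi_{1}(q^{c-a-\ell};q^{c};q,xq^{a+\ell})$$ and $$\Psi_{2}(q^{a};p^{b},q^{c};q,p,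x,y)=\frac{1}{(q^{c};q)_{\infty}(x;q)_{\infty}}\sum_{\ell=0}^{\infty}\frac{(q^{a};q)_{\ell}}{(p^{b};p)_{\ell}(p;p)_{\ell}}(xq^{a+\ell};q)_{\infty}\,y^{\ell}\;{}_{1}\phi_{1}(x;xq^{a+\ell};q,q^{c}).$$
   Context: $q,p\in\mathbb{C}$ are two independent bases with $0<|q|<1$, $0<|p|<1$; logarithms of $q$ and $p$ are fixed so that $q^{a}=e^{a\log q}$, $p^{b}=e^{b\log p}$ for complex exponents. $(A;q)_{0}=1$, $(A;q)_{k}=\prod_{r=0}^{k-1}(1-Aq^{r})$ for $k\ge1$, $(A;q)_\infty=\prod_{r\ge0}(1-Aq^r)$ (similarly with base $p$). The basic hypergeometric function ${}_1\phi_1$ is the standard one: ${}_{1}\phi_{1}(A;C;q,z)=\sum_{k\ge0}\frac{(A;q)_k}{(C;q)_k(q;q)_k}(-1)^{k}q^{k(k-1)/2}z^{k}$. The bibasic Humbert functions are, for $|x|,|y|<1$ and whenever no denominator factor vanishes, $$\Psi_{1}(q^{a},p^{b};p^{c},q^{d};q,p,x,y)=\sum_{\ell,k=0}^{\infty}\frac{(q^{a};q)_{k+\ell}(p^{b};p)_{\ell}}{(p^{c};p)_{\ell}(q^{d};q)_{k}(q;q)_{k}(p;p)_{\ell}}x^{k}y^{\ell},$$ $$\Psi_{2}(q^{a};p^{b},q^{c};q,p,x,y)=\sum_{\ell,k=0}^{\infty}\frac{(q^{a};q)_{k+\ell}}{(p^{b};p)_{\ell}(q^{c};q)_{k}(q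;q)_{k}(p;p)_{\ell}}x^{k}y^{\ell}.$$
   Formalization: In the second formulas of (I) and (II), 1phi1(x; xq^{a+l}; q, .) is undefined if xq^{a+l}=q^{-n}; they are proved assuming this never happens, and also without that assumption with (w;q)_inf 1phi1(x;w;q,.) read as its limit at w=xq^{a+l}. *)

(* Defs.v *)
From Stdlib Require Import Reals List.
From Coquelicot Require Import Coquelicot.

Open Scope C_scope.

Definition Cexp (z : C) : C :=
  (exp (Re z) * cos (Im z), exp (Re z) * sin (Im z))%R.

(** [cpow lq a] is the complex power [q^a = exp (a log q)], where [lq] is the
    chosen value of [log q]; different choices give different powers. *)
Definition cpow (lq a : C) : C := Cexp (a * lq).

(** Total limit along a filter, meaningful only when the limit exists; see
    [Clim_unique]. *)
Definition Clim {T : Type} (f : T -> C) (F : (T -> Prop) -> Prop) : C :=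
  lim (T := C_CompleteNormedModule) (filtermap f F).

Definition Cseries (a : nat -> C) : C :=
  Clim (fun n => sum_n a n) eventually.

(** Finite sets of index pairs are represented by duplicate-free lists. *)
Definition finite_subsets : (list (nat * nat) -> Prop) -> Prop :=
  fun P => exists s0, forall s, NoDup s -> incl s0 s -> P s.

(** Unordered sum of a double family: no order of summation is privileged. *)
Definition Csum2 (f : nat -> nat -> C) : C :=
  Clim (fun s => fold_right Cplus 0 (map (fun i => f (fst i) (snd i)) s))
       finite_subsets.

(** [(A; q)_k] *)
Fixpoint qpoch (A q : C) (k : nat) : C :=
  match k with
  | O => 1
  | S r => qpoch A q r * (1 - A * q ^ r)
  end.

(** [(A; q)_oo] *)
Definition qpoch_inf (A q : C) : C := Clim (qpoch A q) eventually.

(** [1phi1 (A; B; q, z)]; meaningful only when no [(B; q)_k] vanishes. *)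
Definition phi11 (A B q z : C) : C :=
  Cseries (fun k =>
    qpoch A q k / (qpoch B q k * qpoch q q k)
    * (- (1)) ^ k * q ^ (k * (k - 1) / 2) * z ^ k).

(** In the Humbert functions the parameters [A], [B], ... stand for the powers
    [q^a], [p^b], ... themselves, as in the usual notation. *)
Definition Psi1 (A B E D q p x y : C) : C :=
  Csum2 (fun l k =>
    qpoch A q (k + l) * qpoch B p l
    / (qpoch E p l * qpoch D q k * qpoch q q k * qpoch p p l)
    * x ^ k * y ^ l).

Definition Psi2 (A B E q p x y : C) : C :=
  Csum2 (fun l k =>
    qpoch A q (k + l)
    / (qpoch B p l * qpoch E q k * qpoch q q k * qpoch p p l)
    * x ^ k * y ^ l).

Lemma finite_subsets_proper : ProperFilter finite_subsets.
Proof.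
split.
- intros P [s0 H].
  exists (nodup (fun i j : nat * nat => ltac:(decide equality; apply Nat.eq_dec)) s0).
  apply H; [apply NoDup_nodup | intros i Hi; now apply nodup_In].
- split.
  + now exists nil.
  + intros P Q [s H] [t K]; exists (s ++ t); intros u Hu Hi; split.
    * apply H; auto; intros i Hs; apply Hi, in_or_app; auto.
    * apply K; auto; intros i Hs; apply Hi, in_or_app; auto.
  + intros P Q HPQ [s H]; exists s; auto.
Qed.

Lemma Clim_unique {T : Type} (F : (T -> Prop) -> Prop) (f : T -> C) (l : C) :
  ProperFilter F ->
  filterlim f F (locally (T := C_UniformSpace) l) -> Clim f F = l.
Proof.
intros HF Hl.
apply (eq_close (K := C_AbsRing) (V := C_NormedModule)), close_sym.
intros eps.
set (e := pos_div_2 eps).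
assert (PF : ProperFilter (filtermap f F)) by now apply filtermap_proper_filter.
assert (HC : cauchy (T := C_UniformSpace) (filtermap f F)).
{ intros d; exists l; apply Hl; now exists d. }
pose proof (complete_cauchy (T := C_CompleteNormedModule) _ PF HC e) as H1.
assert (H2 : filtermap f F (ball (M := C_UniformSpace) l e))
  by (apply Hl; now exists e).
destruct (filter_ex (F := filtermap f F) _ (filter_and _ _ H1 H2)) as [z [K1 K2]].
replace (pos eps) with (e + e)%R by (unfold e; simpl; field).
apply (ball_triangle (M := C_UniformSpace) _ z); auto.
now apply ball_sym.
Qed.

(* Main.v *)
(* By [(A; q)_(k+l) = (A; q)_l (A q^l; q)_k], a Humbert function is
   [sum_l c_l y^l F_l] with [F_l = 2phi1 (A q^l, 0; D; q, x)], and the theorem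
   is two transformations of [2phi1 (A, 0; D; q, x)].  The first says that
   multiplication by [(x; q)_oo] turns it into [1phi1 (D/A; D; q, x A)]; this is
   the q-Vandermonde sum, read off the Cauchy product with Euler's expansion of
   [(x; q)_oo].  The second is Heine's: expand [(D q^k; q)_oo] by Euler, swap the
   sums and apply the q-binomial theorem.  It yields the series
   [sum_k (x; q)_k (-D)^k q^(k(k-1)/2) (w q^k; q)_oo / (q; q)_k] at [w = x A],
   which is continuous in [w] and so also gives the limit form at the poles of
   [1phi1].  All double series are dominated by products [u_l v_k] of
   summable sequences, so every rearrangement is legitimate. *)
Require Import Defs.
From Stdlib Require Import Reals List Permutation FinFun Lra Lia.
From Coquelicot Require Import Coquelicot.
Open Scope C_scope.

(** * Limits and series of complex numbers *)

(** The infinite product (z; q)_oo is handled through Euler's series: it is entire, its first-order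
    q-difference equation is read off the coefficients, and iterating that equation yields
    convergence of the product, its non-vanishing, and bounds for (z; q)_n and its reciprocal. The
    factor (A; q)_(k+l) is the only one that mixes the two indices of a Humbert term; a uniform
    bound for it keeps the domination in product form. Both transformations are degenerate cases of
    classical ones, with a numerator parameter b of 2phi1 tending to 0. The first comes from
    Jackson's passage from 2phi1 to 2phi2. The second comes from Heine's, where (D/b; q)_k b^k tends
    to (-D)^k q^(k(k-1)/2); this is why D ends up as the argument and x as a parameter. The obstacle
    in the second is that 1phi1 (x; w; q, D) is undefined at w = q^(-n), a value that x q^(a+l) may
    take; the zeros of (w; q)_oo there compensate. *)

Local Notation tends f F l := (filterlim f F (locally (T := C_UniformSpace) l)).
Local Notation cseries a l := (is_series (K := C_AbsRing) (V := C_NormedModule) a l).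

Lemma tends_Cmod {T : Type} (F : (T -> Prop) -> Prop) {FF : Filter F}
    (f : T -> C) (l : C) :
  tends f F l <-> forall eps : posreal, F (fun t => Cmod (f t - l) < eps)%R.
Proof.
exact (filterlim_locally_ball_norm (K := C_AbsRing) (U := C_NormedModule) f l).
Qed.

(** Two uniform structures live on the complex numbers, the product one and the one given by the
    modulus; [locally_C] translates, because [filterlim_mult] speaks of the second. *)
Lemma tends_mult {T : Type} (F : (T -> Prop) -> Prop) {FF : Filter F}
    (f g : T -> C) (l m : C) :
  tends f F l -> tends g F m -> tends (fun t => f t * g t) F (l * m).
Proof.
intros Hf Hg P HP; apply locally_C in HP.
apply (filterlim_comp_2 f g Cmult (F := F) (G := locally (T := AbsRing_UniformSpace C_AbsRing) l)
  (H := locally (T := AbsRing_UniformSpace C_AbsRing) m)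
  (I := locally (T := AbsRing_UniformSpace C_AbsRing) (l * m))); auto.
- intros Q HQ; apply Hf; now apply locally_C.
- intros Q HQ; apply Hg; now apply locally_C.
- exact (filterlim_mult (K := C_AbsRing) l m).
Qed.

Lemma tends_plus {T : Type} (F : (T -> Prop) -> Prop) {FF : Filter F}
    (f g : T -> C) (l m : C) :
  tends f F l -> tends g F m -> tends (fun t => f t + g t) F (l + m).
Proof.
intros Hf Hg.
apply (filterlim_comp_2 f g Cplus Hf Hg).
exact (filterlim_plus (K := C_AbsRing) (V := C_NormedModule) l m).
Qed.

Lemma tends_const {T : Type} (F : (T -> Prop) -> Prop) {FF : Filter F} (l : C) :
  tends (fun _ : T => l) F l.
Proof. apply filterlim_const. Qed.

Lemma tends_unique {T : Type} (F : (T -> Prop) -> Prop) {FF : ProperFilter F}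
    (f : T -> C) (l m : C) : tends f F l -> tends f F m -> l = m.
Proof.
intros Hl Hm; rewrite <- (Clim_unique F f l FF Hl); now apply Clim_unique.
Qed.

Lemma tends_ext_eventually {T : Type} (F : (T -> Prop) -> Prop) {FF : Filter F}
    (f g : T -> C) (l : C) : F (fun t => f t = g t) -> tends f F l -> tends g F l.
Proof. intros H; now apply filterlim_ext_loc. Qed.

Lemma tends_inv {T : Type} (F : (T -> Prop) -> Prop) {FF : Filter F}
    (f : T -> C) (l : C) : l <> 0 -> tends f F l -> tends (fun t => / f t) F (/ l).
Proof.
intros Hl Hf; apply (tends_Cmod F); intros eps; pose proof (proj1 (tends_Cmod F f l) Hf) as Hf'.
assert (L : (0 < Cmod l)%R) by now apply Cmod_gt_0.
(* Closeness within |l|/2 keeps |f t| above |l|/2; the radius eps |l|^2 / 2 is then what makes |f t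
   - l| / (|f t| |l|) smaller than eps. *)
assert (E1 : (0 < Cmod l / 2)%R) by lra.
assert (E2 : (0 < eps * (Cmod l * Cmod l) / 2)%R)
  by (pose proof (cond_pos eps); apply Rdiv_lt_0_compat; [|lra];
      now repeat apply Rmult_lt_0_compat).
generalize (filter_and _ _ (Hf' (mkposreal _ E1)) (Hf' (mkposreal _ E2))).
apply filter_imp; simpl; intros t [H1 H2].
assert (K : (Cmod l / 2 < Cmod (f t))%R).
{ pose proof (Cmod_triangle (f t) (- (f t - l))) as H.
  rewrite Cmod_opp in H; replace (f t + - (f t - l)) with l in H by ring; lra. }
assert (N : f t <> 0) by (apply Cmod_gt_0; lra).
replace (/ f t - / l) with (- (f t - l) * / (f t * l)) by (field; auto).
rewrite Cmod_mult, Cmod_opp, Cmod_inv, Cmod_mult by now apply Cmult_neq_0.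
apply (Rmult_lt_reg_r (Cmod (f t) * Cmod l)).
{ apply Rmult_lt_0_compat; lra. }
rewrite Rmult_assoc, Rinv_l, Rmult_1_r
  by (apply Rgt_not_eq, Rmult_lt_0_compat; lra).
apply (Rlt_le_trans _ _ _ H2).
pose proof (cond_pos eps).
assert (eps * Cmod l * (Cmod l / 2) <= eps * Cmod l * Cmod (f t))%R; [|lra].
apply Rmult_le_compat_l; [apply Rmult_le_pos|]; lra.
Qed.

Definition bounded (c : nat -> C) : Prop :=
  exists M, (0 <= M)%R /\ forall n, (Cmod (c n) <= M)%R.

Lemma tends_bounded (u : nat -> C) (l : C) :
  tends u eventually l -> bounded u.
Proof.
intros H; destruct (proj1 (tends_Cmod eventually u l) H (mkposreal 1 Rlt_0_1)) as [N HN].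
simpl in HN.
assert (B : exists M, forall n, (n <= N)%nat -> (Cmod (u n) <= M)%R).
{ clear HN; induction N as [|N [M IH]].
  - exists (Cmod (u 0%nat)); intros n Hn; replace n with 0%nat by lia; lra.
  - exists (Rmax M (Cmod (u (S N)))); intros n Hn.
    destruct (Nat.eq_dec n (S N)) as [->|Hne]; [apply Rmax_r|].
    eapply Rle_trans; [apply IH; lia | apply Rmax_l]. }
destruct B as [M HM]; exists (Rmax M (1 + Cmod l)); split.
- pose proof (Cmod_ge_0 l); pose proof (Rmax_r M (1 + Cmod l)); lra.
- intros n; destruct (Nat.le_gt_cases n N) as [Hn|Hn].
  + eapply Rle_trans; [now apply HM | apply Rmax_l].
  + eapply Rle_trans; [|apply Rmax_r].
    replace (u n) with ((u n - l) + l) by ring.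
    pose proof (Cmod_triangle (u n - l) l); specialize (HN n ltac:(lia)); lra.
Qed.

Lemma tends_Cmod_le {T : Type} (F : (T -> Prop) -> Prop) {FF : ProperFilter F}
    (f : T -> C) (l m : C) (B : R) :
  tends f F l -> F (fun t => (Cmod (f t - m) <= B)%R) -> (Cmod (l - m) <= B)%R.
Proof.
intros Hf HB; apply le_epsilon; intros eps He.
pose proof (proj1 (tends_Cmod F f l) Hf) as Hf'.
destruct (filter_ex _ (filter_and _ _ HB (Hf' (mkposreal eps He)))) as [t [H1 H2]].
simpl in H2.
replace (l - m) with (- (f t - l) + (f t - m)) by ring.
pose proof (Cmod_triangle (- (f t - l)) (f t - m)) as H; rewrite Cmod_opp in H; lra.
Qed.

Lemma Cseries_unique (a : nat -> C) (l : C) : cseries a l -> Cseries a = l.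
Proof. apply Clim_unique, eventually_filter. Qed.

Lemma cseries_scal (c : C) (a : nat -> C) (l : C) :
  cseries a l -> cseries (fun n => c * a n) (c * l).
Proof. exact (is_series_scal_l (K := C_AbsRing) (V := C_NormedModule) c a l). Qed.

Lemma cseries_plus (a b : nat -> C) (l m : C) :
  cseries a l -> cseries b m -> cseries (fun n => a n + b n) (l + m).
Proof. exact (is_series_plus (K := C_AbsRing) (V := C_NormedModule) a b l m). Qed.

Lemma cseries_decr_1 (a : nat -> C) (l : C) :
  cseries (fun n => a (S n)) (l - a 0%nat) -> cseries a l.
Proof. exact (is_series_decr_1 (K := C_AbsRing) (V := C_NormedModule) a l). Qed.

Lemma cseries_ext (a b : nat -> C) (l : C) :
  (forall n, a n = b n) -> cseries a l -> cseries b l.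
Proof. apply is_series_ext. Qed.

Lemma cseries_uniq (a : nat -> C) (l m : C) : cseries a l -> cseries a m -> l = m.
Proof.
intros Hl Hm; now rewrite <- (Cseries_unique a l Hl), (Cseries_unique a m Hm).
Qed.

Lemma cseries_dominated (a : nat -> C) (b : nat -> R) :
  (forall n, Cmod (a n) <= b n)%R -> ex_series b -> exists l, cseries a l.
Proof.
intros H Hb.
exact (ex_series_le (K := C_AbsRing) (V := C_CompleteNormedModule) a b H Hb).
Qed.

Lemma sum_n_Cmod_diff (a : nat -> C) (b : nat -> R) (N M : nat) :
  (forall n, Cmod (a n) <= b n)%R -> (N <= M)%nat ->
  (Cmod (sum_n a M - sum_n a N) <= sum_n b M - sum_n b N)%R.
Proof.
intros H; induction 1 as [|M HM IH].
- replace (sum_n a N - sum_n a N) with (RtoC 0) by ring; rewrite Cmod_0; lra.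
- rewrite !sum_Sn; change (plus (sum_n a M) (a (S M))) with (sum_n a M + a (S M)).
  change (plus (sum_n b M) (b (S M))) with (sum_n b M + b (S M))%R.
  replace (sum_n a M + a (S M) - sum_n a N)
    with ((sum_n a M - sum_n a N) + a (S M)) by ring.
  pose proof (Cmod_triangle (sum_n a M - sum_n a N) (a (S M))).
  specialize (H (S M)); lra.
Qed.

Lemma sum_n_le_series (b : nat -> R) (B : R) (N : nat) :
  (forall n, 0 <= b n)%R -> is_series b B -> (sum_n b N <= B)%R.
Proof.
intros H HB.
apply (is_lim_seq_incr_compare (sum_n b) B); [exact HB|].
intros n; rewrite sum_Sn; change plus with Rplus; specialize (H (S n)); lra.
Qed.

Lemma cseries_tail (a : nat -> C) (b : nat -> R) (l : C) (B : R) (N : nat) :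
  (forall n, Cmod (a n) <= b n)%R -> is_series b B -> cseries a l ->
  (Cmod (l - sum_n a N) <= B - sum_n b N)%R.
Proof.
intros H HB Ha.
assert (H0 : forall n, (0 <= b n)%R)
  by (intros n; eapply Rle_trans; [apply Cmod_ge_0 | apply H]).
apply (tends_Cmod_le eventually (sum_n a)); [exact Ha|].
exists N; intros M HM.
pose proof (sum_n_Cmod_diff a b N M H HM); pose proof (sum_n_le_series b B M H0 HB).
lra.
Qed.

Lemma tends_sum_n {T : Type} (F : (T -> Prop) -> Prop) {FF : Filter F}
    (f : T -> nat -> C) (l : nat -> C) (N : nat) :
  (forall k, tends (fun t => f t k) F (l k)) ->
  tends (fun t => sum_n (f t) N) F (sum_n l N).
Proof.
intros H; induction N as [|N IH].
- apply (filterlim_ext (fun t => f t 0%nat)); [intros t; now rewrite sum_O|].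
  rewrite sum_O; apply H.
- apply (filterlim_ext (fun t => sum_n (f t) N + f t (S N)));
    [intros t; now rewrite sum_Sn|].
  rewrite sum_Sn; now apply tends_plus.
Qed.

(* Tannery's theorem. *)
Lemma tends_series {T : Type} (F : (T -> Prop) -> Prop) {FF : Filter F}
    (f : T -> nat -> C) (l : nat -> C) (b : nat -> R) (s : T -> C) (L : C) :
  (forall k, tends (fun t => f t k) F (l k)) ->
  ex_series b ->
  F (fun t => forall k, (Cmod (f t k) <= b k)%R) ->
  (forall k, (Cmod (l k) <= b k)%R) ->
  F (fun t => cseries (f t) (s t)) -> cseries l L ->
  tends s F L.
Proof.
intros Hk [B HB] Hb Hl Hs HL; apply (tends_Cmod F); intros eps.
assert (E : (0 < eps / 3)%R) by (pose proof (cond_pos eps); lra).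
(* [N] depends on the majorant alone, so the tails are below eps/3 for all dominated [t] at once. *)
assert (HT : exists N, (B - sum_n b N < eps / 3)%R).
{ destruct (proj2 (is_lim_seq_spec (sum_n b) B) HB (mkposreal _ E)) as [N HN].
  exists N; specialize (HN N (le_n N)); simpl in HN.
  apply Rabs_lt_between in HN; lra. }
destruct HT as [N HN].
pose proof (proj1 (tends_Cmod F _ _) (tends_sum_n F f l N Hk) (mkposreal _ E)) as HF.
generalize (filter_and _ _ HF (filter_and _ _ Hb Hs)).
apply filter_imp; simpl; intros t [H1 [H2 H3]].
pose proof (cseries_tail (f t) b (s t) B N H2 HB H3) as T1.
pose proof (cseries_tail l b L B N Hl HB HL) as T2.
replace (s t - L) with ((s t - sum_n (f t) N)
  + ((sum_n (f t) N - sum_n l N) + - (L - sum_n l N))) by ring.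
eapply Rle_lt_trans; [apply Cmod_triangle|].
pose proof (Cmod_triangle (sum_n (f t) N - sum_n l N) (- (L - sum_n l N))) as T3.
rewrite Cmod_opp in T3; lra.
Qed.

(** * Unordered double sums *)

#[local] Existing Instance finite_subsets_proper.

Definition lsum {I : Type} (f : I -> C) (s : list I) : C :=
  fold_right Cplus 0 (map f s).

Definition lsumR {I : Type} (g : I -> R) (s : list I) : R :=
  fold_right Rplus 0%R (map g s).

(** [lsum] unfolds to the fold inside [Csum2], so this is by conversion the convergence that gives
    [Csum2 f] its meaning. *)
Definition has_sum2 (f : nat -> nat -> C) (S : C) : Prop :=
  tends (lsum (fun i => f (fst i) (snd i))) finite_subsets S.

Lemma Csum2_unique (f : nat -> nat -> C) (S : C) : has_sum2 f S -> Csum2 f = S.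
Proof. apply Clim_unique, finite_subsets_proper. Qed.

Lemma lsum_app {I : Type} (f : I -> C) (s t : list I) :
  lsum f (s ++ t) = lsum f s + lsum f t.
Proof.
induction s as [|i s IH]; unfold lsum in *; simpl; [ring | rewrite IH; ring].
Qed.

Lemma lsumR_app {I : Type} (g : I -> R) (s t : list I) :
  lsumR g (s ++ t) = (lsumR g s + lsumR g t)%R.
Proof.
induction s as [|i s IH]; unfold lsumR in *; simpl; [ring | rewrite IH; ring].
Qed.

Lemma lsum_perm {I : Type} (f : I -> C) (s t : list I) :
  Permutation s t -> lsum f s = lsum f t.
Proof.
induction 1; unfold lsum in *; simpl; [easy | now rewrite IHPermutation | ring |].
now transitivity (fold_right Cplus 0 (map f l')).
Qed.

Lemma lsumR_perm {I : Type} (g : I -> R) (s t : list I) :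
  Permutation s t -> lsumR g s = lsumR g t.
Proof.
induction 1; unfold lsumR in *; simpl; [easy | now rewrite IHPermutation | ring |].
now transitivity (fold_right Rplus 0%R (map g l')).
Qed.

Lemma lsum_map {I J : Type} (h : I -> J) (f : J -> C) (s : list I) :
  lsum f (map h s) = lsum (fun i => f (h i)) s.
Proof. unfold lsum; now rewrite map_map. Qed.

Lemma lsum_list_prod {I J : Type} (f : I * J -> C) (s : list I) (t : list J) :
  lsum f (list_prod s t) = lsum (fun i => lsum (fun j => f (i, j)) t) s.
Proof.
induction s as [|i s IH]; [easy|]; simpl; rewrite lsum_app, lsum_map, IH; easy.
Qed.

Lemma lsum_seq (f : nat -> C) (n : nat) : lsum f (seq 0 (S n)) = sum_n f n.
Proof.
induction n as [|n IH].
- unfold lsum; simpl; rewrite sum_O; ring.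
- rewrite seq_S, lsum_app, IH, sum_Sn; unfold lsum; simpl.
  change plus with Cplus; ring.
Qed.

Lemma lsumR_list_prod {I J : Type} (u : I -> R) (v : J -> R)
    (s : list I) (t : list J) :
  lsumR (fun i => u (fst i) * v (snd i))%R (list_prod s t)
  = (lsumR u s * lsumR v t)%R.
Proof.
assert (K : forall i, lsumR (fun i => u (fst i) * v (snd i))%R (map (fun j => (i, j)) t)
  = (u i * lsumR v t)%R).
{ intros i; unfold lsumR; rewrite map_map.
  induction t as [|j t IH]; simpl in *; [ring | rewrite IH; ring]. }
induction s as [|i s IH]; [unfold lsumR; simpl; ring|].
simpl list_prod; rewrite lsumR_app, IH, K.
change (lsumR u (i :: s)) with (u i + lsumR u s)%R; ring.
Qed.

Lemma lsumR_seq (f : nat -> R) (n : nat) : lsumR f (seq 0 (S n)) = sum_n f n.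
Proof.
induction n as [|n IH].
- unfold lsumR; simpl; rewrite sum_O; ring.
- rewrite seq_S, lsumR_app, IH, sum_Sn; unfold lsumR; simpl.
  change plus with Rplus; ring.
Qed.

Lemma lsumR_ge_0 {I : Type} (g : I -> R) (s : list I) :
  (forall i, 0 <= g i)%R -> (0 <= lsumR g s)%R.
Proof.
intros H; induction s as [|i s IH]; unfold lsumR in *; simpl; [lra|].
specialize (H i); lra.
Qed.

Lemma lsum_dominated {I : Type} (f : I -> C) (g : I -> R) (s : list I) :
  (forall i, Cmod (f i) <= g i)%R -> (Cmod (lsum f s) <= lsumR g s)%R.
Proof.
intros H; induction s as [|i s IH]; unfold lsum, lsumR in *; simpl.
- rewrite Cmod_0; lra.
- eapply Rle_trans; [apply Cmod_triangle | specialize (H i); lra].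
Qed.

Lemma pair_eq_dec (i j : nat * nat) : {i = j} + {i <> j}.
Proof. decide equality; apply Nat.eq_dec. Qed.

(** Differences of finite sums over nested index sets become sums over the remainder [u], which can
    be estimated. *)
Lemma NoDup_incl_split (s t : list (nat * nat)) :
  NoDup s -> NoDup t -> incl s t ->
  exists u, Permutation t (s ++ u) /\ NoDup u.
Proof.
intros Hs Ht Hi.
exists (filter (fun i => if in_dec pair_eq_dec i s then false else true) t).
assert (N : NoDup (filter (fun i => if in_dec pair_eq_dec i s then false else true) t))
  by now apply NoDup_filter.
split; [|exact N].
apply NoDup_Permutation; [exact Ht| |].
- apply NoDup_app; auto; intros i Hin Hf; apply filter_In in Hf as [_ Hf].
  now destruct (in_dec pair_eq_dec i s).
- intros i; rewrite in_app_iff, filter_In.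
  destruct (in_dec pair_eq_dec i s) as [K|K]; split; intros H; auto.
  + destruct H as [H|[H _]]; auto.
Qed.

Lemma lsumR_incl (g : nat * nat -> R) (s t : list (nat * nat)) :
  (forall i, 0 <= g i)%R -> NoDup s -> NoDup t -> incl s t ->
  (lsumR g s <= lsumR g t)%R.
Proof.
intros H Hs Ht Hi; destruct (NoDup_incl_split s t Hs Ht Hi) as [u [Hp _]].
rewrite (lsumR_perm g _ _ Hp), lsumR_app; pose proof (lsumR_ge_0 g u H); lra.
Qed.

Lemma NoDup_list_prod {I J : Type} (s : list I) (t : list J) :
  NoDup s -> NoDup t -> NoDup (list_prod s t).
Proof.
intros Hs Ht; induction Hs as [|i s Hi Hs IH]; simpl; [constructor|].
apply NoDup_app; [|exact IH|].
- apply Injective_map_NoDup; [|exact Ht]; intros j j' H; congruence.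
- intros [i' j'] H1 H2; apply in_map_iff in H1 as [j [H1 _]].
  apply in_prod_iff in H2 as [H2 _]; congruence.
Qed.

Definition rect (M K : nat) : list (nat * nat) :=
  list_prod (seq 0 (S M)) (seq 0 (S K)).

Lemma NoDup_rect (M K : nat) : NoDup (rect M K).
Proof. apply NoDup_list_prod; apply seq_NoDup. Qed.

Lemma in_rect (M K l k : nat) : In (l, k) (rect M K) <-> (l <= M /\ k <= K)%nat.
Proof. unfold rect; rewrite in_prod_iff, !in_seq; lia. Qed.

Lemma list_bound (s : list (nat * nat)) :
  exists N, forall l k, In (l, k) s -> (l + k <= N)%nat.
Proof.
induction s as [|[l k] s [N IH]]; [now exists 0%nat|].
exists (max N (l + k)); intros l' k' [H|H]; [injection H as <- <-; lia|].
specialize (IH _ _ H); lia.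
Qed.

Lemma lsum_rect (f : nat -> nat -> C) (M K : nat) :
  lsum (fun i => f (fst i) (snd i)) (rect M K)
  = sum_n (fun l => sum_n (f l) K) M.
Proof.
unfold rect; rewrite lsum_list_prod, <- lsum_seq; unfold lsum at 1 3; f_equal.
apply map_ext; intros l; simpl fst; simpl snd; apply lsum_seq.
Qed.

(* If the finite sums of [g] are bounded, a finite set nearly attaining their
   supremum leaves almost nothing for the sums of [f] outside it. *)
Lemma has_sum2_exists (f : nat -> nat -> C) (g : nat * nat -> R) (B : R) :
  (forall l k, Cmod (f l k) <= g (l, k))%R ->
  (forall s, NoDup s -> (lsumR g s <= B)%R) ->
  exists S, has_sum2 f S.
Proof.
intros H HB.
assert (H' : forall i, (Cmod (f (fst i) (snd i)) <= g i)%R) by (intros [l k]; apply H).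
apply (filterlim_locally_cauchy (U := C_CompleteNormedModule)
  (FF := finite_subsets_proper)).
intros eps.
destruct (completeness (fun r => exists s, NoDup s /\ r = lsumR g s)) as [sg [U L]].
{ exists B; intros r [s [Hs ->]]; auto. }
{ exists 0%R, nil; split; [constructor | easy]. }
assert (E : exists s0, NoDup s0 /\ (sg - eps / 2 < lsumR g s0)%R).
{ destruct (Classical_Prop.classic (exists s0, NoDup s0 /\ (sg - eps / 2 < lsumR g s0)%R))
    as [K|K]; [exact K|exfalso].
  assert (sg <= sg - eps / 2)%R; [|pose proof (cond_pos eps); lra].
  apply L; intros r [s [Hs ->]]; apply Rnot_lt_le; intros Hr; apply K; now exists s. }
destruct E as [s0 [N0 E0]].
assert (D : forall s, NoDup s -> incl s0 s ->
  (Cmod (lsum (fun i => f (fst i) (snd i)) s - lsum (fun i => f (fst i) (snd i)) s0)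
   < eps / 2)%R).
{ intros s Hs Hi; destruct (NoDup_incl_split s0 s N0 Hs Hi) as [u [Hp _]].
  rewrite (lsum_perm _ _ _ Hp), lsum_app.
  replace (lsum (fun i => f (fst i) (snd i)) s0 + lsum (fun i => f (fst i) (snd i)) u
    - lsum (fun i => f (fst i) (snd i)) s0) with (lsum (fun i => f (fst i) (snd i)) u)
    by ring.
  apply (Rle_lt_trans _ (lsumR g u)); [now apply lsum_dominated|].
  assert (K : (lsumR g s <= sg)%R) by (apply U; now exists s).
  rewrite (lsumR_perm g _ _ Hp), lsumR_app in K; lra. }
exists (fun s => NoDup s /\ incl s0 s); split; [now exists s0|].
intros s t [Hs Is] [Ht It].
apply (norm_compat1 (K := C_AbsRing) (V := C_NormedModule)).
change (Cmod (lsum (fun i => f (fst i) (snd i)) t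
  - lsum (fun i => f (fst i) (snd i)) s) < eps)%R.
pose proof (D s Hs Is) as D1; pose proof (D t Ht It) as D2.
rewrite <- Cmod_opp in D1.
match type of D2 with (Cmod ?a < _)%R => match type of D1 with (Cmod ?b < _)%R =>
  pose proof (Cmod_triangle a b) as T end end.
match goal with |- (Cmod ?a < _)%R => match type of T with (Cmod ?b <= _)%R =>
  replace a with b by ring end end.
lra.
Qed.

Definition dominated2 (f : nat -> nat -> C) : Prop :=
  exists u v : nat -> R, ex_series u /\ ex_series v /\
    (forall n, 0 <= u n)%R /\ (forall n, 0 <= v n)%R /\
    forall l k, (Cmod (f l k) <= u l * v k)%R.

(** Any finite index set lies in a square, over which the sum of the products [u l * v k] factors;
    hence [U * V] bounds all finite sums. *)
Lemma dominated2_sum (f : nat -> nat -> C) : dominated2 f -> exists S, has_sum2 f S.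
Proof.
intros [u [v [[U HU] [[V HV] [Pu [Pv H]]]]]].
assert (P : forall i : nat * nat, (0 <= u (fst i) * v (snd i))%R)
  by (intros i; now apply Rmult_le_pos).
apply (has_sum2_exists f (fun i => u (fst i) * v (snd i))%R (U * V)%R); [exact H|].
intros s Hs; destruct (list_bound s) as [N HN].
apply (Rle_trans _ (lsumR (fun i => u (fst i) * v (snd i))%R (rect N N))).
- apply lsumR_incl; auto using NoDup_rect.
  intros [l k] Hi; apply in_rect; specialize (HN _ _ Hi); lia.
- unfold rect; rewrite lsumR_list_prod, !lsumR_seq.
  apply Rmult_le_compat; try now apply sum_n_le_series.
  + rewrite <- lsumR_seq; now apply lsumR_ge_0.
  + rewrite <- lsumR_seq; now apply lsumR_ge_0.
Qed.

(** Sets containing all pairs with l + k <= n eventually contain any given finite set, so an ordered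
    exhaustion inherits the unordered limit. *)
Lemma has_sum2_along (f : nat -> nat -> C) (S : C) (s : nat -> list (nat * nat)) :
  has_sum2 f S -> (forall n, NoDup (s n)) ->
  (forall n l k, (l + k <= n)%nat -> In (l, k) (s n)) ->
  tends (fun n => lsum (fun i => f (fst i) (snd i)) (s n)) eventually S.
Proof.
intros HS Hs Hi P HP; destruct (HS P HP) as [s0 H].
destruct (list_bound s0) as [N HN]; exists N; intros n Hn.
apply H; [apply Hs|]; intros [l k] Hin; apply Hi.
specialize (HN _ _ Hin); lia.
Qed.

Lemma has_sum2_rows (f : nat -> nat -> C) (S : C) (r : nat -> C) :
  has_sum2 f S -> (forall l, cseries (f l) (r l)) -> cseries r S.
Proof.
intros HS Hr; apply (tends_Cmod eventually); intros eps.
assert (E : (0 < eps / 2)%R) by (pose proof (cond_pos eps); lra).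
destruct (proj1 (tends_Cmod finite_subsets _ _) HS (mkposreal _ E))
  as [s0 H].
destruct (list_bound s0) as [N HN]; exists N; intros M HM.
apply (Rle_lt_trans _ (eps / 2)%R); [|pose proof (cond_pos eps); lra].
(* For fixed [M], rectangles with [K] large are within eps/2 of [S]. The limit in [K] preserves this
   only as a weak inequality, hence the halving. *)
apply (tends_Cmod_le eventually (fun K => sum_n (fun l => sum_n (f l) K) M)).
- exact (tends_sum_n eventually (fun K l => sum_n (f l) K) r M Hr).
- exists N; intros K HK; rewrite <- lsum_rect; apply Rlt_le, H; [apply NoDup_rect|].
  intros [l k] Hin; apply in_rect; specialize (HN _ _ Hin); lia.
Qed.

Lemma has_sum2_swap (f : nat -> nat -> C) (S : C) :
  has_sum2 f S -> has_sum2 (fun l k => f k l) S.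
Proof.
intros HS P HP; destruct (HS P HP) as [s0 H].
set (sw := fun i : nat * nat => (snd i, fst i)).
exists (map sw s0); intros s Hs Hi.
replace (lsum (fun i => f (snd i) (fst i)) s)
  with (lsum (fun i => f (fst i) (snd i)) (map sw s)) by now rewrite lsum_map.
apply H.
- apply Injective_map_NoDup; [|exact Hs].
  intros [a b] [c d]; unfold sw; simpl; congruence.
- intros [l k] Hin; apply in_map_iff; exists (k, l); split; [easy|].
  apply Hi, in_map_iff; now exists (l, k).
Qed.

(** Grown by one antidiagonal at a time, so that each increment of the finite sum is one coefficient
    of a Cauchy product. *)
Fixpoint triangle (n : nat) : list (nat * nat) :=
  match n with
  | O => ((0, 0) :: nil)%nat
  | S m => triangle m ++ map (fun k => (k, n - k)%nat) (seq 0 (S n))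
  end.

Lemma in_triangle (n l k : nat) : In (l, k) (triangle n) <-> (l + k <= n)%nat.
Proof.
induction n as [|n IH].
- simpl; split; [intros [H|[]]; injection H as <- <-; lia|].
  intros H; left; f_equal; lia.
- cbn [triangle]; rewrite in_app_iff, IH, in_map_iff; split.
  + intros [H|[j [H Hj]]]; [lia|]; apply in_seq in Hj; apply pair_equal_spec in H; lia.
  + intros H; destruct (Nat.eq_dec (l + k) (S n)) as [E|E]; [right|left; lia].
    exists l; split; [f_equal; lia | apply in_seq; lia].
Qed.

Lemma NoDup_triangle (n : nat) : NoDup (triangle n).
Proof.
induction n as [|n IH]; [repeat constructor; easy|].
cbn [triangle]; apply NoDup_app; [exact IH| |].
- apply Injective_map_NoDup; [|apply seq_NoDup]; intros j j' H; congruence.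
- intros [l k] H1 H2; apply in_triangle in H1; apply in_map_iff in H2 as [j [H2 H3]].
  apply in_seq in H3; apply pair_equal_spec in H2; lia.
Qed.

Lemma has_sum2_diag (f : nat -> nat -> C) (S : C) :
  has_sum2 f S -> cseries (fun n => sum_n (fun k => f k (n - k)%nat) n) S.
Proof.
intros HS.
apply (filterlim_ext (fun n => lsum (fun i => f (fst i) (snd i)) (triangle n))).
- induction x as [|n IH].
  + rewrite !sum_O; unfold lsum; simpl; ring.
  + cbn [triangle]; rewrite lsum_app, IH, lsum_map, lsum_seq, (sum_Sn (fun n0 => sum_n _ n0)); easy.
- apply (has_sum2_along f S triangle HS NoDup_triangle).
  intros n l k; apply in_triangle.
Qed.

(** * Euler's expansion and the q-binomial theorem *)

Lemma one_minus_neq_0 (z : C) : (Cmod z < 1)%R -> 1 - z <> 0.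
Proof.
intros H E; assert (K : z = 1) by (replace z with (1 - (1 - z)) by ring; rewrite E; ring).
rewrite K, Cmod_1 in H; lra.
Qed.

Lemma Cmod_pow_le_1 (q : C) (n : nat) : (Cmod q < 1)%R -> (Cmod (q ^ n) <= 1)%R.
Proof.
intros H; rewrite Cmod_pow, <- (pow1 n); apply pow_incr.
split; [apply Cmod_ge_0 | lra].
Qed.

Lemma Cmod_mult_pow_le (z q : C) (n : nat) :
  (Cmod q < 1)%R -> (Cmod (z * q ^ n) <= Cmod z)%R.
Proof.
intros H; rewrite Cmod_mult.
pose proof (Rmult_le_compat_l _ _ _ (Cmod_ge_0 z) (Cmod_pow_le_1 q n H)); lra.
Qed.

Lemma tends_pow_0 (q z : C) :
  (Cmod q < 1)%R -> tends (fun n => z * q ^ n) eventually (RtoC 0).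
Proof.
intros H; rewrite <- (Cmult_0_r z).
apply tends_mult; [apply eventually_filter | apply tends_const, eventually_filter |].
apply (tends_Cmod eventually); intros eps.
assert (K : is_lim_seq (fun n => Cmod q ^ n)%R 0).
{ apply is_lim_seq_geom; rewrite Rabs_pos_eq; [exact H | apply Cmod_ge_0]. }
destruct (proj2 (is_lim_seq_spec _ 0) K eps) as [N HN]; exists N; intros n Hn.
specialize (HN n Hn); simpl in HN; rewrite Rminus_0_r in HN.
replace (q ^ n - 0) with (q ^ n) by ring; rewrite Cmod_pow.
eapply Rle_lt_trans; [apply Rle_abs | exact HN].
Qed.

(** Ratio test: from [N] on, a geometric series dominates. *)
Lemma ex_series_ratio (a : nat -> R) (N : nat) (t : R) :
  (forall n, 0 <= a n)%R -> (0 <= t < 1)%R ->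
  (forall n, (N <= n)%nat -> (a (S n) <= t * a n)%R) -> ex_series a.
Proof.
intros H0 Ht H; apply (ex_series_incr_n (K := R_AbsRing) (V := R_NormedModule) a N).
apply (ex_series_le (K := R_AbsRing) (V := R_CompleteNormedModule) _
  (fun n => a N * t ^ n)%R).
- intros n; change norm with Rabs; rewrite Rabs_pos_eq by apply H0.
  induction n as [|n IH]; [rewrite Nat.add_0_r; simpl; lra|].
  rewrite <- plus_n_Sm; eapply Rle_trans; [apply H; lia|].
  simpl; apply (Rmult_le_compat_l t) in IH; [|lra].
  eapply Rle_trans; [exact IH|]; right; ring.
- apply (ex_series_scal_l (K := R_AbsRing) (V := R_NormedModule)).
  exists (/ (1 - t))%R; apply is_series_geom; rewrite Rabs_pos_eq; lra.
Qed.

Lemma qpoch_add (A q : C) (l k : nat) :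
  qpoch A q (l + k) = qpoch A q l * qpoch (A * q ^ l) q k.
Proof.
induction k as [|k IH]; [rewrite Nat.add_0_r; simpl; ring|].
rewrite <- plus_n_Sm; simpl; rewrite IH, Cpow_add_r; ring.
Qed.

Lemma qpoch_neq_0 (A q : C) (k : nat) :
  (forall n, 1 - A * q ^ n <> 0) -> qpoch A q k <> 0.
Proof.
intros H; induction k as [|k IH]; simpl.
- injection; lra.
- now apply Cmult_neq_0.
Qed.

Lemma one_minus_qS_neq_0 (q : C) (k : nat) :
  (Cmod q < 1)%R -> 1 - q * q ^ k <> 0.
Proof.
intros H; apply one_minus_neq_0; eapply Rle_lt_trans; [|exact H].
now apply Cmod_mult_pow_le.
Qed.

Lemma qpoch_qq_neq_0 (q : C) (k : nat) : (Cmod q < 1)%R -> qpoch q q k <> 0.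
Proof. intros H; apply qpoch_neq_0; intros n; now apply one_minus_qS_neq_0. Qed.

Lemma half_binom_S (k : nat) : (S k * (S k - 1) / 2 = k + k * (k - 1) / 2)%nat.
Proof.
replace (S k * (S k - 1))%nat with (k * (k - 1) + k * 2)%nat by (destruct k; simpl; lia).
rewrite Nat.div_add by lia; lia.
Qed.

(** Writing f for the power series, f(z) - f(z q) has coefficients c_k (1 - q^k); the recurrence
    turns it into B z f(z) - A z f(z q). Euler's series is the case A = 1, B = 0, and the q-binomial
    series the case B = 1. *)
Lemma qdiff_series (q A B z s t : C) (c : nat -> C)
    (hc : forall k, c (S k) * (1 - q * q ^ k) = c k * (B - A * q ^ k)) :
  cseries (fun k => c k * z ^ k) s -> cseries (fun k => c k * (z * q) ^ k) t ->
  (1 - B * z) * s = (1 - A * z) * t.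
Proof.
intros Hs Ht.
assert (L : cseries (fun k => c k * z ^ k + - (1) * (c k * (z * q) ^ k)) (s + - (1) * t)).
{ apply cseries_plus; [exact Hs|].
  now apply cseries_scal. }
assert (R : cseries (fun k => c k * z ^ k + - (1) * (c k * (z * q) ^ k))
  (B * z * s + - (A * z) * t)).
{ apply cseries_decr_1.
  replace (B * z * s + - (A * z) * t
    - (c 0%nat * z ^ 0 + - (1) * (c 0%nat * (z * q) ^ 0)))
    with (B * z * s + - (A * z) * t) by (simpl; ring).
  apply (cseries_ext (fun k => B * z * (c k * z ^ k) + - (A * z) * (c k * (z * q) ^ k))).
  - intros k; rewrite !Cpow_mult_l, !Cpow_S.
    transitivity (z * z ^ k * (c k * (B - A * q ^ k))); [ring|].
    rewrite <- hc; ring.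
  - exact (cseries_plus _ _ _ _ (cseries_scal _ _ _ Hs) (cseries_scal _ _ _ Ht)). }
pose proof (cseries_uniq _ _ _ L R) as E.
transitivity (s + - (1) * t + t - B * z * s); [ring | rewrite E; ring].
Qed.

Definition euler_coef (q : C) (k : nat) : C :=
  (- (1)) ^ k * q ^ (k * (k - 1) / 2) / qpoch q q k.

Lemma euler_coef_S (q : C) (k : nat) : (Cmod q < 1)%R ->
  euler_coef q (S k) * (1 - q * q ^ k) = - q ^ k * euler_coef q k.
Proof.
intros H; unfold euler_coef; rewrite half_binom_S, Cpow_add_r; simpl qpoch.
rewrite Cpow_S; field; split; [now apply qpoch_qq_neq_0 | now apply one_minus_qS_neq_0].
Qed.

(** Consecutive coefficients have ratio -q^k / (1 - q^(k+1)), which tends to 0, so the radius of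
    convergence is infinite. *)
Lemma euler_coef_summable (q : C) (r : R) : (Cmod q < 1)%R -> (0 <= r)%R ->
  ex_series (fun k => Cmod (euler_coef q k) * r ^ k)%R.
Proof.
intros H Hr.
assert (K : is_lim_seq (fun n => Cmod q ^ n)%R 0).
{ apply is_lim_seq_geom; rewrite Rabs_pos_eq; [exact H | apply Cmod_ge_0]. }
(* Once |q|^n is below this threshold, |1 - q^(n+1)| >= 1 - |q| makes the ratio of the terms at
   radius r at most 1/2; r + 1 avoids dividing by 0. *)
assert (E : (0 < (1 - Cmod q) / (2 * (r + 1)))%R) by (apply Rdiv_lt_0_compat; lra).
destruct (proj2 (is_lim_seq_spec _ 0) K (mkposreal _ E)) as [N HN]; simpl in HN.
apply (ex_series_ratio _ N (1 / 2)); [|lra|].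
- intros n; apply Rmult_le_pos; [apply Cmod_ge_0 | now apply pow_le].
- intros n Hn; specialize (HN n Hn); rewrite Rminus_0_r in HN.
  rewrite Rabs_pos_eq in HN by (apply pow_le, Cmod_ge_0).
  assert (D : (1 - Cmod q <= Cmod (1 - q * q ^ n))%R).
  { pose proof (Cmod_mult_pow_le q q n H).
    pose proof (Cmod_triangle (1 - q * q ^ n) (q * q ^ n)) as T.
    replace (1 - q * q ^ n + q * q ^ n) with (RtoC 1) in T by ring.
    rewrite Cmod_1 in T; lra. }
  pose proof (f_equal Cmod (euler_coef_S q n H)) as X.
  rewrite !Cmod_mult, Cmod_opp, Cmod_pow in X.
  pose proof (Cmod_ge_0 (euler_coef q n)) as P.
  pose proof (Cmod_ge_0 (euler_coef q (S n))) as P'.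
  assert (Y : (Cmod (euler_coef q (S n)) * (1 - Cmod q)
    <= Cmod q ^ n * Cmod (euler_coef q n))%R)
    by (rewrite <- X; now apply Rmult_le_compat_l).
  assert (Z : (Cmod (euler_coef q (S n)) * r <= 1 / 2 * Cmod (euler_coef q n))%R).
  { apply (Rmult_le_reg_r (1 - Cmod q)); [lra|].
    apply (Rmult_lt_compat_r (2 * (r + 1))) in HN; [|lra].
    unfold Rdiv in HN; rewrite Rmult_assoc, Rinv_l, Rmult_1_r in HN by lra.
    assert (0 <= Cmod q ^ n)%R by (apply pow_le, Cmod_ge_0).
    apply (Rmult_le_compat_l r) in Y; [|lra].
    apply Rlt_le, (Rmult_le_compat_r _ _ _ P) in HN.
    assert (0 <= Cmod q ^ n * Cmod (euler_coef q n))%R by now apply Rmult_le_pos.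
    lra. }
  simpl; apply (Rmult_le_compat_r (r ^ n)) in Z; [|now apply pow_le]; lra.
Qed.

Lemma euler_term_le (q z : C) (r : R) (k : nat) : (Cmod z <= r)%R ->
  (Cmod (euler_coef q k * z ^ k) <= Cmod (euler_coef q k) * r ^ k)%R.
Proof.
intros Hz; rewrite Cmod_mult, Cmod_pow.
apply Rmult_le_compat_l; [apply Cmod_ge_0|].
apply pow_incr; split; [apply Cmod_ge_0 | exact Hz].
Qed.

(** The sum is (z; q)_oo, as [qpoch_inf_euler] shows; the series form gives continuity in [z] by
    Tannery's theorem. *)
Definition euler (q z : C) : C := Cseries (fun k => euler_coef q k * z ^ k).

Lemma euler_series (q z : C) : (Cmod q < 1)%R ->
  cseries (fun k => euler_coef q k * z ^ k) (euler q z).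
Proof.
intros H.
destruct (cseries_dominated (fun k => euler_coef q k * z ^ k) _
  (fun k => euler_term_le q z _ k (Rle_refl _))
  (euler_coef_summable q (Cmod z) H (Cmod_ge_0 z))) as [l Hl].
unfold euler; now rewrite (Cseries_unique _ l Hl).
Qed.

Lemma locally_Cmod_le (w : C) (F := locally (T := C_UniformSpace) w) :
  F (fun z => Cmod z <= Cmod w + 1)%R.
Proof.
assert (H : tends (fun z : C => z) F w) by apply filterlim_id.
generalize (proj1 (tends_Cmod F _ w) H (mkposreal 1 Rlt_0_1)).
apply filter_imp; simpl; intros z Hz.
pose proof (Cmod_triangle (z - w) w) as T.
replace (z - w + w) with z in T by ring; lra.
Qed.

Lemma tends_pow {T : Type} (F : (T -> Prop) -> Prop) {FF : Filter F}
    (f : T -> C) (l : C) (k : nat) :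
  tends f F l -> tends (fun t => f t ^ k) F (l ^ k).
Proof.
intros H; induction k as [|k IH]; simpl; [now apply tends_const|].
now apply tends_mult.
Qed.

Lemma euler_continuous (q w : C) : (Cmod q < 1)%R ->
  tends (euler q) (locally (T := C_UniformSpace) w) (euler q w).
Proof.
intros H.
apply (tends_series _ (fun z k => euler_coef q k * z ^ k)
  (fun k => euler_coef q k * w ^ k)
  (fun k => Cmod (euler_coef q k) * (Cmod w + 1) ^ k)%R).
- intros k; apply tends_mult; [apply locally_filter | |].
  + apply tends_const, locally_filter.
  + apply tends_pow; [apply locally_filter | apply filterlim_id].
- apply euler_coef_summable; [exact H|]; pose proof (Cmod_ge_0 w); lra.
- generalize (locally_Cmod_le w); apply filter_imp.
  intros z Hz k; now apply euler_term_le.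
- intros k; apply euler_term_le; lra.
- apply filter_forall; intros z; now apply euler_series.
- now apply euler_series.
Qed.

Lemma euler_0 (q : C) : (Cmod q < 1)%R -> euler q 0 = 1.
Proof.
intros H; apply Cseries_unique.
apply cseries_decr_1.
assert (E : euler_coef q 0 = 1) by (unfold euler_coef; simpl; field; injection; lra).
(* The terms after the first vanish; that they sum to 0 is obtained by scaling the convergent Euler
   series by 0. *)
replace (1 - _) with (RtoC 0 * RtoC 0) by (rewrite E; simpl; ring).
apply (cseries_ext (fun k => 0 * (euler_coef q k * 0 ^ k))).
- intros k; simpl; ring.
- replace (0 * 0) with (0 * euler q 0) by ring; now apply cseries_scal, euler_series.
Qed.

Lemma euler_qdiff (q z : C) : (Cmod q < 1)%R ->
  euler q z = (1 - z) * euler q (z * q).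
Proof.
intros H.
transitivity ((1 - 0 * z) * euler q z); [ring|].
transitivity ((1 - 1 * z) * euler q (z * q)); [|ring].
apply (qdiff_series q 1 0 z _ _ (euler_coef q)); try now apply euler_series.
intros k; rewrite euler_coef_S by exact H; ring.
Qed.

Lemma euler_shift (q z : C) (n : nat) : (Cmod q < 1)%R ->
  euler q z = qpoch z q n * euler q (z * q ^ n).
Proof.
intros H; induction n as [|n IH]; simpl.
- replace (z * 1) with z by ring; ring.
- rewrite IH, (euler_qdiff q (z * q ^ n) H).
  replace (z * q ^ n * q) with (z * (q * q ^ n)) by ring; ring.
Qed.

Lemma tends_euler_shift (q z : C) : (Cmod q < 1)%R ->
  tends (fun n => euler q (z * q ^ n)) eventually (RtoC 1).
Proof.
intros H; rewrite <- (euler_0 q H).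
apply (filterlim_comp _ _ _ (fun n => z * q ^ n) (euler q) _
  (locally (T := C_UniformSpace) (RtoC 0))); [now apply tends_pow_0 | now apply euler_continuous].
Qed.

Lemma tends_neq_0 {T : Type} (F : (T -> Prop) -> Prop) {FF : Filter F}
    (f : T -> C) (l : C) : l <> 0 -> tends f F l -> F (fun t => f t <> 0).
Proof.
intros Hl Hf.
generalize (proj1 (tends_Cmod F f l) Hf (mkposreal _ (proj1 (Cmod_gt_0 l) Hl))).
apply filter_imp; simpl; intros t Ht E; rewrite E in Ht.
replace (0 - l) with (- l) in Ht by ring; rewrite Cmod_opp in Ht; lra.
Qed.

(** By the iterated functional equation (z; q)_n is the quotient of [euler q z] by
    [euler q (z * q ^ n)], and the divisor tends to 1. It may vanish for small n, so the quotient is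
    used only eventually. *)
Lemma qpoch_tends (q z : C) : (Cmod q < 1)%R ->
  tends (qpoch z q) eventually (euler q z).
Proof.
intros H; pose proof (tends_euler_shift q z H) as T.
assert (N : RtoC 1 <> 0) by (injection; lra).
apply (tends_ext_eventually eventually (fun n => euler q z * / euler q (z * q ^ n))).
- generalize (tends_neq_0 eventually _ 1 N T); apply filter_imp; intros n Hn.
  rewrite (euler_shift q z n H); now field.
- replace (euler q z) with (euler q z * / 1) at 1 by (field; exact N).
  apply tends_mult; [apply eventually_filter | apply tends_const, eventually_filter |].
  now apply tends_inv; [apply eventually_filter | |].
Qed.

Lemma qpoch_inf_euler (q z : C) : (Cmod q < 1)%R -> qpoch_inf z q = euler q z.
Proof. intros H; apply Clim_unique; [apply eventually_filter | now apply qpoch_tends]. Qed.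

(** Some shifted value [euler q (z * q ^ n)] is nonzero because these tend to 1; the finite product
    split off has no zero factor. *)
Lemma euler_neq_0 (q z : C) : (Cmod q < 1)%R ->
  (forall n, 1 - z * q ^ n <> 0) -> euler q z <> 0.
Proof.
intros H Hz.
assert (N : RtoC 1 <> 0) by (injection; lra).
destruct (tends_neq_0 eventually _ 1 N (tends_euler_shift q z H)) as [n Hn].
rewrite (euler_shift q z n H); apply Cmult_neq_0; [now apply qpoch_neq_0|].
now apply Hn.
Qed.

Lemma euler_neq_0_disc (q z : C) : (Cmod q < 1)%R -> (Cmod z < 1)%R -> euler q z <> 0.
Proof.
intros H Hz; apply euler_neq_0; [exact H|]; intros n; apply one_minus_neq_0.
eapply Rle_lt_trans; [now apply Cmod_mult_pow_le | exact Hz].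
Qed.

Lemma qpoch_bounded (q z : C) : (Cmod q < 1)%R -> bounded (qpoch z q).
Proof. intros H; exact (tends_bounded _ _ (qpoch_tends q z H)). Qed.

Lemma qpoch_inv_bounded (q z : C) : (Cmod q < 1)%R -> (forall n, 1 - z * q ^ n <> 0) ->
  bounded (fun n => / qpoch z q n).
Proof.
intros H Hz; apply (tends_bounded _ (/ euler q z)).
apply tends_inv; [apply eventually_filter | now apply euler_neq_0 | now apply qpoch_tends].
Qed.

Lemma bounded_mult (c d : nat -> C) :
  bounded c -> bounded d -> bounded (fun n => c n * d n).
Proof.
intros [M [HM H]] [N [HN K]]; exists (M * N)%R; split; [now apply Rmult_le_pos|].
intros n; rewrite Cmod_mult; apply Rmult_le_compat; auto using Cmod_ge_0.
Qed.

Lemma bounded_pow_le (c : nat -> C) (x : C) : bounded c -> (Cmod x < 1)%R ->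
  exists u, ex_series u /\ (forall n, 0 <= u n)%R /\
    forall n, (Cmod (c n * x ^ n) <= u n)%R.
Proof.
intros [M [HM H]] Hx; exists (fun n => M * Cmod x ^ n)%R; split; [|split].
- apply (ex_series_scal_l (K := R_AbsRing) (V := R_NormedModule)).
  exists (/ (1 - Cmod x))%R; apply is_series_geom.
  rewrite Rabs_pos_eq; [exact Hx | apply Cmod_ge_0].
- intros n; apply Rmult_le_pos; [exact HM | apply pow_le, Cmod_ge_0].
- intros n; rewrite Cmod_mult, Cmod_pow.
  apply Rmult_le_compat_r; [apply pow_le, Cmod_ge_0 | apply H].
Qed.

Lemma bounded_series (c : nat -> C) (x : C) : bounded c -> (Cmod x < 1)%R ->
  exists s, cseries (fun n => c n * x ^ n) s.
Proof.
intros Hc Hx; destruct (bounded_pow_le c x Hc Hx) as [u [Hu [_ H]]].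
exact (cseries_dominated _ u H Hu).
Qed.

Lemma binom_coef_bounded (q A : C) : (Cmod q < 1)%R ->
  bounded (fun k => qpoch A q k / qpoch q q k).
Proof.
intros H; apply bounded_mult; [now apply qpoch_bounded|].
apply qpoch_inv_bounded; [exact H|]; intros n; now apply one_minus_qS_neq_0.
Qed.

(** The sum f satisfies (1 - z) f(z) = (1 - A z) f(z q). Iterating drives the argument to 0, where f
    is 1, and the two finite products converge to the infinite ones. *)
Lemma q_binomial (q A z : C) : (Cmod q < 1)%R -> (Cmod z < 1)%R ->
  cseries (fun k => qpoch A q k / qpoch q q k * z ^ k) (euler q (A * z) / euler q z).
Proof.
intros H Hz; set (c := fun k => qpoch A q k / qpoch q q k).
assert (Hc : bounded c) by now apply binom_coef_bounded.
set (f := fun w => Cseries (fun k => c k * w ^ k)).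
assert (Hf : forall w, (Cmod w < 1)%R -> cseries (fun k => c k * w ^ k) (f w)).
{ intros w Hw; destruct (bounded_series c w Hc Hw) as [s Hs].
  unfold f; now rewrite (Cseries_unique _ s Hs). }
assert (Hr : forall k, c (S k) * (1 - q * q ^ k) = c k * (1 - A * q ^ k)).
{ intros k; unfold c; simpl; field; split;
    [now apply qpoch_qq_neq_0 | now apply one_minus_qS_neq_0]. }
assert (Hn : forall n, (Cmod (z * q ^ n) < 1)%R)
  by (intros n; eapply Rle_lt_trans; [now apply Cmod_mult_pow_le | exact Hz]).
assert (It : forall n, qpoch z q n * f z = qpoch (A * z) q n * f (z * q ^ n)).
{ induction n as [|n IH]; simpl; [now replace (z * 1) with z by ring|].
  transitivity (qpoch z q n * f z * (1 - z * q ^ n)); [ring|].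
  rewrite IH.
  assert (E : (1 - 1 * (z * q ^ n)) * f (z * q ^ n)
    = (1 - A * (z * q ^ n)) * f (z * q ^ n * q)).
  { apply (qdiff_series q A 1 _ _ _ c Hr); [now apply Hf|].
    apply Hf; replace (z * q ^ n * q) with (z * q ^ S n) by (simpl; ring); apply Hn. }
  replace (z * (q * q ^ n)) with (z * q ^ n * q) by ring.
  transitivity (qpoch (A * z) q n * ((1 - 1 * (z * q ^ n)) * f (z * q ^ n))); [ring|].
  rewrite E; ring. }
(* The terms at z q^n are dominated by those at z, so limits may be taken termwise; only the
   constant term survives. *)
assert (T1 : tends (fun n => f (z * q ^ n)) eventually (RtoC 1)).
{ destruct (bounded_pow_le c z Hc Hz) as [u [Hu [Pu Bu]]].
  apply (tends_series eventually (fun n k => c k * (z * q ^ n) ^ k)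
    (fun k => match k with O => 1 | S _ => 0 end) u); auto.
  - intros [|k].
    + replace (RtoC 1) with (c 0%nat * 1) by (unfold c; simpl; field; injection; lra).
      apply (tends_const eventually (c 0%nat * 1)).
    + replace (RtoC 0) with (c (S k) * 0 ^ S k) by (simpl; ring).
      apply tends_mult; [apply eventually_filter | apply tends_const, eventually_filter |].
      apply tends_pow; [apply eventually_filter | now apply tends_pow_0].
  - apply filter_forall; intros n k; eapply Rle_trans; [|apply Bu].
    rewrite !Cmod_mult; apply Rmult_le_compat_l; [apply Cmod_ge_0|].
    rewrite !Cmod_pow; apply pow_incr; split; [apply Cmod_ge_0|].
    now apply Cmod_mult_pow_le.
  - intros [|k]; [|rewrite Cmod_0; apply Pu].
    replace (RtoC 1) with (c 0%nat * z ^ 0) by (unfold c; simpl; field; injection; lra).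
    apply Bu.
  - apply filter_forall; intros n; apply Hf, Hn.
  - apply cseries_decr_1.
    replace (1 - 1) with (0 * f z) by ring.
    apply (cseries_ext (fun k => 0 * (c k * z ^ k))); [intros k; ring|].
    now apply cseries_scal, Hf. }
assert (L : euler q z * f z = euler q (A * z) * 1).
{ apply (tends_unique eventually (fun n => qpoch z q n * f z)).
  - apply tends_mult; [apply eventually_filter | now apply qpoch_tends |].
    apply tends_const, eventually_filter.
  - apply (filterlim_ext (fun n => qpoch (A * z) q n * f (z * q ^ n)));
      [intros n; now rewrite It|].
    apply tends_mult; [apply eventually_filter | now apply qpoch_tends | exact T1]. }
replace (euler q (A * z) / euler q z) with (f z); [now apply Hf|].
pose proof (euler_neq_0_disc q z H Hz) as N.
transitivity (euler q z * f z / euler q z); [now field | rewrite L; now field].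
Qed.

(** * Transformations of [2phi1 (A, 0; D; q, x)] *)

Lemma euler_Cmod_le (q z : C) (r : R) : (Cmod q < 1)%R -> (0 <= r)%R -> (Cmod z <= r)%R ->
  (Cmod (euler q z) <= Series (fun k => Cmod (euler_coef q k) * r ^ k))%R.
Proof.
intros H Hr Hz.
pose proof (Series_correct _ (euler_coef_summable q r H Hr)) as HB.
pose proof (cseries_tail _ _ _ _ 0 (fun k => euler_term_le q z r k Hz) HB
  (euler_series q z H)) as T.
rewrite !sum_O in T; pose proof (euler_term_le q z r 0 Hz) as T0.
pose proof (Cmod_triangle (euler q z - euler_coef q 0 * z ^ 0) (euler_coef q 0 * z ^ 0)) as T1.
replace (euler q z - euler_coef q 0 * z ^ 0 + euler_coef q 0 * z ^ 0)
  with (euler q z) in T1 by ring.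
lra.
Qed.

Definition heine_term (q x D w : C) (k : nat) : C :=
  qpoch x q k * (euler_coef q k * D ^ k) * euler q (w * q ^ k).

(* The entire function [w |-> (w; q)_oo 1phi1 (x; w; q, D)]. *)
Definition heine (q x D w : C) : C := Cseries (heine_term q x D w).

Lemma heine_term_bound (q x D : C) (r : R) : (Cmod q < 1)%R -> (0 <= r)%R ->
  exists b, ex_series b /\
    forall w k, (Cmod w <= r)%R -> (Cmod (heine_term q x D w k) <= b k)%R.
Proof.
intros H Hr; destruct (qpoch_bounded q x H) as [M [HM B]].
set (E := Series (fun k => Cmod (euler_coef q k) * r ^ k)%R).
exists (fun k => M * E * (Cmod (euler_coef q k) * Cmod D ^ k))%R; split.
- apply (ex_series_scal_l (K := R_AbsRing) (V := R_NormedModule)).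
  apply euler_coef_summable; [exact H | apply Cmod_ge_0].
- intros w k Hw; unfold heine_term; rewrite !Cmod_mult, Cmod_pow.
  assert (K : (Cmod (euler q (w * q ^ k)) <= E)%R).
  { apply euler_Cmod_le; auto; eapply Rle_trans; [now apply Cmod_mult_pow_le | exact Hw]. }
  specialize (B k).
  replace (M * E * (Cmod (euler_coef q k) * Cmod D ^ k))%R
    with (M * (Cmod (euler_coef q k) * Cmod D ^ k) * E)%R by ring.
  assert (P : (0 <= Cmod (euler_coef q k) * Cmod D ^ k)%R)
    by (apply Rmult_le_pos; [apply Cmod_ge_0 | apply pow_le, Cmod_ge_0]).
  apply Rmult_le_compat; [| apply Cmod_ge_0 | | exact K].
  + apply Rmult_le_pos; [apply Cmod_ge_0 | exact P].
  + apply Rmult_le_compat_r; assumption.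
Qed.

Lemma heine_series (q x D w : C) : (Cmod q < 1)%R ->
  cseries (heine_term q x D w) (heine q x D w).
Proof.
intros H; destruct (heine_term_bound q x D (Cmod w) H (Cmod_ge_0 w)) as [b [Hb B]].
destruct (cseries_dominated (heine_term q x D w) b) as [s Hs]; auto using Rle_refl.
unfold heine; now rewrite (Cseries_unique _ s Hs).
Qed.

Lemma heine_continuous (q x D w : C) : (Cmod q < 1)%R ->
  tends (heine q x D) (locally (T := C_UniformSpace) w) (heine q x D w).
Proof.
intros H.
assert (R : (0 <= Cmod w + 1)%R) by (pose proof (Cmod_ge_0 w); lra).
destruct (heine_term_bound q x D (Cmod w + 1) H R) as [b [Hb B]].
apply (tends_series _ (heine_term q x D) (heine_term q x D w) b); auto.
- intros k; apply tends_mult; [apply locally_filter | apply tends_const, locally_filter |].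
  apply (filterlim_comp _ _ _ (fun z => z * q ^ k) (euler q) _
    (locally (T := C_UniformSpace) (w * q ^ k))); [|now apply euler_continuous].
  apply tends_mult; [apply locally_filter | apply filterlim_id |].
  apply tends_const, locally_filter.
- generalize (locally_Cmod_le w); apply filter_imp; auto.
- intros k; apply B; lra.
- apply filter_forall; intros z; now apply heine_series.
- now apply heine_series.
Qed.

(** Termwise, (w; q)_oo / (w; q)_k = (w q^k; q)_oo. The left side needs (w; q)_k to be nonzero, the
    right side is defined for every [w]. *)
Lemma phi11_heine (q x D w : C) : (Cmod q < 1)%R -> (forall n, 1 - w * q ^ n <> 0) ->
  euler q w * phi11 x w q D = heine q x D w.
Proof.
intros H Hw; assert (N : euler q w <> 0) by now apply euler_neq_0.
enough (phi11 x w q D = / euler q w * heine q x D w) as -> by now field.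
apply Cseries_unique.
apply (cseries_ext (fun k => / euler q w * heine_term q x D w k));
  [|now apply cseries_scal, heine_series].
intros k; unfold heine_term, euler_coef.
rewrite (euler_shift q w k H) in N |- *.
field; repeat split; [now apply qpoch_qq_neq_0 | now apply qpoch_neq_0 |].
intros E; apply N; rewrite E; ring.
Qed.

(** * Limits at the poles of 1phi1 *)

Lemma locally'_proper_C (w : C) : ProperFilter (locally' (T := C_UniformSpace) w).
Proof.
split; [|apply locally'_filter].
intros P HP.
destruct (locally_norm_le_locally (K := C_AbsRing) (V := C_NormedModule) w _ HP)
  as [eps He].
assert (E : (0 < eps / 2)%R) by (pose proof (cond_pos eps); lra).
exists (w + RtoC (eps / 2)); apply He.
- change (Cmod (w + RtoC (eps / 2) - w) < eps)%R.
  replace (w + RtoC (eps / 2) - w) with (RtoC (eps / 2)) by ring.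
  rewrite Cmod_R, Rabs_pos_eq; lra.
- intros K; apply (f_equal (fun z => z - w)) in K.
  replace (w + RtoC (eps / 2) - w) with (RtoC (eps / 2)) in K by ring.
  replace (w - w) with (RtoC 0) in K by ring.
  injection K; lra.
Qed.

(** The poles q^(-n) are discrete: for large n they leave the disc of radius |w| + 1, and the
    finitely many others are avoided one at a time. *)
Lemma locally'_pole_free (q w : C) : (0 < Cmod q < 1)%R ->
  locally' (T := C_UniformSpace) w (fun z => forall n, 1 - z * q ^ n <> 0).
Proof.
intros [Hq0 H].
assert (F : Filter (locally' (T := C_UniformSpace) w)) by apply locally'_filter.
assert (Q : q <> 0) by now apply Cmod_gt_0.
assert (P1 : forall n, locally' (T := C_UniformSpace) w (fun z => 1 - z * q ^ n <> 0)).
{ intros n; destruct (Ceq_dec (1 - w * q ^ n) 0) as [E|E].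
  - assert (K : forall z : C, z <> w -> 1 - z * q ^ n <> 0).
    { intros z Hz K; apply Hz; pose proof (Cpow_nz q n Q) as Qn.
      transitivity ((1 - (1 - z * q ^ n)) / q ^ n); [now field|].
      rewrite K, <- E; now field. }
    exact (filter_forall (F := locally (T := C_UniformSpace) w) _ K).
  - apply filter_le_within; apply (tends_neq_0 _ (fun z => 1 - z * q ^ n) _ E).
    apply tends_plus; [apply locally_filter | apply tends_const, locally_filter |].
    apply (filterlim_ext (fun z => - (1) * (z * q ^ n))); [intros z; ring|].
    replace (- (w * q ^ n)) with (- (1) * (w * q ^ n)) by ring.
    apply tends_mult; [apply locally_filter | apply tends_const, locally_filter |].
    apply tends_mult; [apply locally_filter | apply filterlim_id |].
    apply tends_const, locally_filter. }
assert (P2 : forall N, locally' (T := C_UniformSpace) w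
  (fun z => forall n, (n < N)%nat -> 1 - z * q ^ n <> 0)).
{ induction N as [|N IH]; [apply filter_forall; intros; lia|].
  generalize (filter_and _ _ IH (P1 N)); apply filter_imp; intros z [A B] n Hn.
  destruct (Nat.eq_dec n N) as [->|Hne]; [exact B | apply A; lia]. }
destruct (proj1 (tends_Cmod eventually _ _) (tends_pow_0 q (RtoC (Cmod w + 1)) H)
  (mkposreal 1 Rlt_0_1)) as [N HN]; simpl in HN.
generalize (filter_and _ _ (P2 N) (filter_le_within _ _ (locally_Cmod_le w))).
apply filter_imp; intros z [A B] n.
destruct (Nat.lt_ge_cases n N) as [Hn|Hn]; [now apply A|].
specialize (HN n Hn).
replace (RtoC (Cmod w + 1) * q ^ n - 0) with (RtoC (Cmod w + 1) * q ^ n) in HN by ring.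
pose proof (Cmod_ge_0 w).
rewrite Cmod_mult, Cmod_R, Rabs_pos_eq in HN by lra.
apply one_minus_neq_0; rewrite Cmod_mult; eapply Rle_lt_trans; [|exact HN].
apply Rmult_le_compat_r; [apply Cmod_ge_0 | exact B].
Qed.

(** Near [w], but off [w], the product agrees with [heine], whose continuity supplies the limit even
    when [w] is a pole. *)
Lemma Clim_phi11_heine (q x D w : C) : (0 < Cmod q < 1)%R ->
  Clim (fun z : C => qpoch_inf z q * phi11 x z q D) (locally' (T := C_UniformSpace) w)
  = heine q x D w.
Proof.
intros H; apply Clim_unique; [apply locally'_proper_C|].
assert (F : Filter (locally' (T := C_UniformSpace) w)) by apply locally'_filter.
apply (tends_ext_eventually _ (heine q x D)).
- generalize (locally'_pole_free q w H); apply filter_imp; intros z Hz.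
  now rewrite qpoch_inf_euler, phi11_heine.
- intros P HP; apply filter_le_within; now apply heine_continuous.
Qed.

(** Coefficient of x^k in 2phi1 (A, 0; D; q, x); the parameter 0 contributes (0; q)_k = 1. *)
Definition phi21_coef (q A D : C) (k : nat) : C :=
  qpoch A q k / (qpoch D q k * qpoch q q k).

Lemma phi21_coef_bounded (q A D : C) : (Cmod q < 1)%R -> (forall n, 1 - D * q ^ n <> 0) ->
  bounded (phi21_coef q A D).
Proof.
intros H HD.
destruct (bounded_mult _ _ (qpoch_inv_bounded q D H HD) (binom_coef_bounded q A H))
  as [M [HM B]].
exists M; split; [exact HM|]; intros n.
replace (phi21_coef q A D n) with (/ qpoch D q n * (qpoch A q n / qpoch q q n)); auto.
unfold phi21_coef; field; split; [now apply qpoch_qq_neq_0 | now apply qpoch_neq_0].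
Qed.

(* Heine's transformation of [2phi1 (A, 0; D; q, x)]: expand
   [(D q^k; q)_oo] by Euler and sum over [k] first, by the q-binomial theorem. *)
Lemma heine_transformation (q A D x F : C) : (Cmod q < 1)%R -> (Cmod x < 1)%R ->
  (forall n, 1 - D * q ^ n <> 0) ->
  cseries (fun k => phi21_coef q A D k * x ^ k) F ->
  euler q D * euler q x * F = heine q x D (x * A).
Proof.
intros H Hx HD HF.
set (c := fun k => qpoch A q k / qpoch q q k).
set (f := fun k m => c k * x ^ k * (euler_coef q m * (D * q ^ k) ^ m)).
assert (Hf : dominated2 f).
{ destruct (bounded_pow_le c x (binom_coef_bounded q A H) Hx) as [u [Hu [Pu Bu]]].
  exists u, (fun m => Cmod (euler_coef q m) * Cmod D ^ m)%R; repeat split; auto.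
  - apply euler_coef_summable; [exact H | apply Cmod_ge_0].
  - intros m; apply Rmult_le_pos; [apply Cmod_ge_0 | apply pow_le, Cmod_ge_0].
  - intros k m; unfold f; rewrite Cmod_mult.
    apply Rmult_le_compat; [apply Cmod_ge_0 | apply Cmod_ge_0 | apply Bu |].
    apply euler_term_le; now apply Cmod_mult_pow_le. }
destruct (dominated2_sum f Hf) as [S HS].
(* Summing over [m] first undoes Euler's expansion, and (D q^k; q)_oo = (D; q)_oo / (D; q)_k
   restores the coefficient of 2phi1. *)
assert (E1 : S = euler q D * F).
{ apply (cseries_uniq (fun k => euler q D * (phi21_coef q A D k * x ^ k)));
    [|now apply cseries_scal].
  apply (has_sum2_rows f); [exact HS|]; intros k.
  replace (euler q D * (phi21_coef q A D k * x ^ k))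
    with (c k * x ^ k * euler q (D * q ^ k)).
  - exact (cseries_scal (c k * x ^ k) _ _ (euler_series q (D * q ^ k) H)).
  - rewrite (euler_shift q D k H); unfold c, phi21_coef; field.
    split; auto using qpoch_neq_0, qpoch_qq_neq_0. }
assert (X : forall m, (Cmod (x * q ^ m) < 1)%R)
  by (intros m; eapply Rle_lt_trans; [now apply Cmod_mult_pow_le | exact Hx]).
assert (E2 : euler q x * S = heine q x D (x * A)).
{ apply (cseries_uniq (heine_term q x D (x * A))); [|now apply heine_series].
  apply (cseries_ext (fun m => euler q x * (/ euler q x * heine_term q x D (x * A) m))).
  { intros m; field; now apply euler_neq_0_disc. }
  apply cseries_scal, (has_sum2_rows (fun m k => f k m)); [now apply has_sum2_swap|].
  intros m.
  (* Since x^k (D q^k)^m = D^m (x q^m)^k, the sum over [k] is a q-binomial series at x q^m; the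
     shift of (x; q)_oo by m produces the factor (x; q)_m. *)
  replace (/ euler q x * heine_term q x D (x * A) m) with
    (euler_coef q m * D ^ m * (euler q (A * (x * q ^ m)) / euler q (x * q ^ m))).
  - apply (cseries_ext (fun k => euler_coef q m * D ^ m * (c k * (x * q ^ m) ^ k))).
    + intros k; unfold f; rewrite !Cpow_mult_l, <- !Cpow_mult_r, (Nat.mul_comm m k); ring.
    + now apply cseries_scal, q_binomial.
  - unfold heine_term; pose proof (euler_neq_0_disc q x H Hx) as N.
    rewrite (euler_shift q x m H) in N |- *.
    replace (A * (x * q ^ m)) with (x * A * q ^ m) by ring.
    assert (N1 : qpoch x q m <> 0) by (intros E; apply N; rewrite E; ring).
    pose proof (euler_neq_0_disc q (x * q ^ m) H (X m)); field; auto. }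
rewrite <- E2, E1; ring.
Qed.

(* A q-Vandermonde summation, proved by telescoping: with
   [t n k = phi21_coef k * euler_coef (n - k)], the combination of [t (S n) k]
   and [t n k] below is a difference in [k]. *)
Lemma vandermonde_partial (q A D : C) (n m : nat) : (Cmod q < 1)%R ->
  (forall n, 1 - D * q ^ n <> 0) -> (m <= n)%nat ->
  sum_n (fun k => (1 - q * q ^ n) * (1 - D * q ^ n)
                    * (phi21_coef q A D k * euler_coef q (S n - k))
                  + q ^ n * (A - D * q ^ n)
                    * (phi21_coef q A D k * euler_coef q (n - k))) m
  = - q ^ (n - m) * (1 - A * q ^ m) * phi21_coef q A D m * euler_coef q (n - m) :> C.
Proof.
intros H HD; induction m as [|m IH]; intros Hm.
- rewrite sum_O, !Nat.sub_0_r.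
  pose proof (euler_coef_S q n H) as E.
  replace (- q ^ n * (1 - A * q ^ 0) * phi21_coef q A D 0 * euler_coef q n)
    with ((1 - A) * phi21_coef q A D 0 * (- q ^ n * euler_coef q n)) by (simpl; ring).
  replace (q ^ n * (A - D * q ^ n) * (phi21_coef q A D 0 * euler_coef q n))
    with (- (A - D * q ^ n) * phi21_coef q A D 0 * (- q ^ n * euler_coef q n)) by ring.
  rewrite <- E; ring.
- rewrite sum_Sn, IH by lia; change plus with Cplus.
  replace (S n - S m)%nat with (S (n - S m)) by lia.
  replace (n - m)%nat with (S (n - S m)) by lia.
  assert (Q : q ^ n = q ^ m * q * q ^ (n - S m)).
  { replace n with (m + 1 + (n - S m))%nat at 1 by lia; rewrite !Cpow_add_r; simpl; ring. }
  rewrite Q; generalize (n - S m)%nat; intros j.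
  pose proof (euler_coef_S q j H) as E.
  assert (R : (1 - q * q ^ m) * (1 - D * q ^ m) * phi21_coef q A D (S m)
    = (1 - A * q ^ m) * phi21_coef q A D m).
  { unfold phi21_coef; simpl qpoch; field.
    repeat split; auto using qpoch_neq_0, qpoch_qq_neq_0, one_minus_qS_neq_0. }
  (* With the recurrences [R] and [E] every term becomes a multiple of [phi21_coef q A D (S m) *
     euler_coef q (S j)], and a polynomial identity remains. *)
  transitivity (- q ^ S j * ((1 - A * q ^ m) * phi21_coef q A D m) * euler_coef q (S j)
    + ((1 - q * (q ^ m * q * q ^ j)) * (1 - D * (q ^ m * q * q ^ j))
         * (phi21_coef q A D (S m) * euler_coef q (S j))
       + - (q ^ m * q) * (A - D * (q ^ m * q * q ^ j)) * phi21_coef q A D (S m)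
         * (- q ^ j * euler_coef q j))); [ring|].
  rewrite <- R, <- E.
  transitivity ((1 - A * q ^ S m) * phi21_coef q A D (S m) * (- q ^ j * euler_coef q j));
    [rewrite <- E; simpl; ring | ring].
Qed.

(** Coefficient of x^n in 1phi1 (D/A; D; q, x A). *)
Definition jackson_coef (q A D : C) (n : nat) : C :=
  qpoch (D / A) q n / (qpoch D q n * qpoch q q n)
  * (- (1)) ^ n * q ^ (n * (n - 1) / 2) * A ^ n.

(** At m = n the telescoped sum lacks only the term k = n + 1 of the next convolution. Adding it
    cancels the boundary term and leaves the recurrence X s_(n+1) = -Y s_n, which [jackson_coef]
    also satisfies. *)
Lemma q_vandermonde (q A D : C) (n : nat) : (Cmod q < 1)%R -> A <> 0 ->
  (forall n, 1 - D * q ^ n <> 0) ->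
  sum_n (fun k => phi21_coef q A D k * euler_coef q (n - k)) n = jackson_coef q A D n :> C.
Proof.
intros H HA HD.
assert (N1 : RtoC 1 <> 0) by (injection; lra).
assert (E0 : euler_coef q 0 = 1) by (unfold euler_coef; simpl; now field).
induction n as [|n IH].
- rewrite sum_O, Nat.sub_diag, E0; unfold phi21_coef, jackson_coef; simpl; field; auto.
- set (X := (1 - q * q ^ n) * (1 - D * q ^ n)).
  set (Y := q ^ n * (A - D * q ^ n)).
  assert (HX : X <> 0) by (apply Cmult_neq_0; auto using one_minus_qS_neq_0).
  pose proof (vandermonde_partial q A D n n H HD (le_n n)) as V.
  fold X Y in V; rewrite Nat.sub_diag, E0 in V.
  assert (V' : X * sum_n (fun k => phi21_coef q A D k * euler_coef q (S n - k)) n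
    + Y * jackson_coef q A D n = - (1) * (1 - A * q ^ n) * phi21_coef q A D n).
  { rewrite <- IH; transitivity (- q ^ 0 * (1 - A * q ^ n) * phi21_coef q A D n * 1);
      [rewrite <- V | simpl; ring].
    rewrite <- !(sum_n_mult_l (K := C_Ring)).
    exact (eq_sym (sum_n_plus (G := C_AbelianMonoid) _ _ n)). }
  rewrite sum_Sn, Nat.sub_diag, E0; change plus with Cplus.
  assert (R : X * phi21_coef q A D (S n) = (1 - A * q ^ n) * phi21_coef q A D n).
  { unfold phi21_coef, X; simpl qpoch; field.
    repeat split; auto using qpoch_neq_0, qpoch_qq_neq_0, one_minus_qS_neq_0. }
  assert (J : X * jackson_coef q A D (S n) = - Y * jackson_coef q A D n).
  { unfold jackson_coef, X, Y; rewrite half_binom_S, Cpow_add_r, !Cpow_S; simpl qpoch.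
    field; repeat split; auto using qpoch_neq_0, qpoch_qq_neq_0, one_minus_qS_neq_0. }
  set (s := sum_n _ n).
  change (X * s + Y * jackson_coef q A D n = - (1) * (1 - A * q ^ n) * phi21_coef q A D n)
    in V'.
  assert (K : X * (s + phi21_coef q A D (S n) * 1) = X * jackson_coef q A D (S n)).
  { rewrite J; transitivity (X * s + X * phi21_coef q A D (S n)); [ring|].
    rewrite R; transitivity (X * s + Y * jackson_coef q A D n - Y * jackson_coef q A D n
      + (1 - A * q ^ n) * phi21_coef q A D n); [ring | rewrite V'; ring]. }
  transitivity (/ X * (X * (s + phi21_coef q A D (S n) * 1))); [now field|].
  rewrite K; now field.
Qed.

Lemma jackson_transformation (q A D x F : C) : (Cmod q < 1)%R -> (Cmod x < 1)%R ->
  A <> 0 -> (forall n, 1 - D * q ^ n <> 0) ->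
  cseries (fun k => phi21_coef q A D k * x ^ k) F ->
  phi11 (D / A) D q (x * A) = euler q x * F.
Proof.
intros H Hx HA HD HF.
set (f := fun k m => phi21_coef q A D k * x ^ k * (euler_coef q m * x ^ m)).
assert (Hf : dominated2 f).
{ destruct (bounded_pow_le _ x (phi21_coef_bounded q A D H HD) Hx) as [u [Hu [Pu Bu]]].
  exists u, (fun m => Cmod (euler_coef q m) * Cmod x ^ m)%R; repeat split; auto.
  - apply euler_coef_summable; [exact H | apply Cmod_ge_0].
  - intros m; apply Rmult_le_pos; [apply Cmod_ge_0 | apply pow_le, Cmod_ge_0].
  - intros k m; unfold f; rewrite Cmod_mult.
    apply Rmult_le_compat; [apply Cmod_ge_0 | apply Cmod_ge_0 | apply Bu |].
    apply euler_term_le, Rle_refl. }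
destruct (dominated2_sum f Hf) as [S HS].
assert (E : S = euler q x * F).
{ apply (cseries_uniq (fun k => euler q x * (phi21_coef q A D k * x ^ k)));
    [|now apply cseries_scal].
  apply (has_sum2_rows f); [exact HS|]; intros k.
  rewrite Cmult_comm; now apply cseries_scal, euler_series. }
rewrite <- E; apply Cseries_unique.
apply (cseries_ext (fun n => sum_n (fun k => f k (n - k)%nat) n));
  [|now apply has_sum2_diag].
intros n.
transitivity (jackson_coef q A D n * x ^ n).
- rewrite <- q_vandermonde by assumption.
  rewrite <- (sum_n_mult_r (K := C_Ring)); apply sum_n_ext_loc; intros k Hk.
  assert (P : x ^ n = x ^ k * x ^ (n - k)) by (rewrite <- Cpow_add_r; f_equal; lia).
  rewrite P; unfold f; change mult with Cmult.
  (* The equation is typed in the carrier of the ring structure; [ring] needs it in [C]. *)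
  match goal with |- @eq _ ?a ?b => change (@eq C a b) end; ring.
- unfold jackson_coef; rewrite Cpow_mult_l; ring.
Qed.

(** * Humbert functions *)

(* The common form of [Psi1] and [Psi2]: the base [p] only enters through the
   bounded factor [c]. *)
Definition humbert_term (q A D x y : C) (c : nat -> C) (l k : nat) : C :=
  qpoch A q (k + l) * c l / (qpoch D q k * qpoch q q k) * x ^ k * y ^ l.

(** Summation over [k] at fixed [l] isolates a 2phi1 with [A] replaced by [A * q ^ l], to which
    either transformation applies. *)
Lemma humbert_rows (q A D x y : C) (c : nat -> C) :
  (Cmod q < 1)%R -> (Cmod x < 1)%R -> (Cmod y < 1)%R ->
  (forall n, 1 - D * q ^ n <> 0) -> bounded c ->
  exists F : nat -> C,
    (forall l, cseries (fun k => phi21_coef q (A * q ^ l) D k * x ^ k) (F l)) /\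
    cseries (fun l => qpoch A q l * c l * y ^ l * F l)
      (Csum2 (humbert_term q A D x y c)).
Proof.
intros H Hx Hy HD Hc.
set (F := fun l => Cseries (fun k => phi21_coef q (A * q ^ l) D k * x ^ k)).
assert (HF : forall l, cseries (fun k => phi21_coef q (A * q ^ l) D k * x ^ k) (F l)).
{ intros l; destruct (bounded_series _ x (phi21_coef_bounded q (A * q ^ l) D H HD) Hx)
    as [s Hs].
  unfold F; now rewrite (Cseries_unique _ s Hs). }
exists F; split; [exact HF|].
assert (Hd : dominated2 (humbert_term q A D x y c)).
(* The single bound [M] for (A; q)_(k+l), valid for all indices, separates [l] from [k]. *)
{ destruct (qpoch_bounded q A H) as [M [HM BM]].
  destruct (bounded_pow_le c y Hc Hy) as [u [Hu [Pu Bu]]].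
  assert (Hv : bounded (fun k => / qpoch D q k * / qpoch q q k)).
  { apply bounded_mult; apply qpoch_inv_bounded; auto.
    intros n; now apply one_minus_qS_neq_0. }
  destruct (bounded_pow_le _ x Hv Hx) as [v [Hvs [Pv Bv]]].
  exists (fun l => M * u l)%R, v; repeat split; auto.
  - exact (ex_series_scal_l (K := R_AbsRing) (V := R_NormedModule) M u Hu).
  - intros l; now apply Rmult_le_pos.
  - intros l k.
    replace (humbert_term q A D x y c l k) with (qpoch A q (k + l) * (c l * y ^ l)
      * (/ qpoch D q k * / qpoch q q k * x ^ k))
      by (unfold humbert_term; field; auto using qpoch_neq_0, qpoch_qq_neq_0).
    rewrite Cmod_mult, (Cmod_mult (qpoch A q (k + l))).
    repeat apply Rmult_le_compat; auto using Cmod_ge_0.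
    apply Rmult_le_pos; apply Cmod_ge_0. }
destruct (dominated2_sum _ Hd) as [S HS]; rewrite (Csum2_unique _ S HS).
apply (has_sum2_rows _ _ _ HS); intros l.
apply (cseries_ext (fun k => qpoch A q l * c l * y ^ l
  * (phi21_coef q (A * q ^ l) D k * x ^ k))); [|now apply cseries_scal].
intros k; unfold humbert_term, phi21_coef; rewrite Nat.add_comm, qpoch_add.
field; auto using qpoch_neq_0, qpoch_qq_neq_0.
Qed.

Lemma Cseries_scaled (a b : nat -> C) (K S : C) : K <> 0 ->
  (forall l, b l = K * a l) -> cseries a S -> S = 1 / K * Cseries b.
Proof.
intros HK Hb Ha; rewrite (Cseries_unique b (K * S)); [now field|].
apply (cseries_ext (fun l => K * a l)); [easy | now apply cseries_scal].
Qed.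

Lemma humbert_phi11 (q A D x y : C) (c : nat -> C) :
  (0 < Cmod q < 1)%R -> (Cmod x < 1)%R -> (Cmod y < 1)%R ->
  A <> 0 -> (forall n, 1 - D * q ^ n <> 0) -> bounded c ->
  Csum2 (humbert_term q A D x y c) = 1 / qpoch_inf x q *
    Cseries (fun l => qpoch A q l * c l * y ^ l
      * phi11 (D / (A * q ^ l)) D q (x * (A * q ^ l))).
Proof.
intros [Q H] Hx Hy HA HD Hc.
destruct (humbert_rows q A D x y c H Hx Hy HD Hc) as [F [HF S]].
rewrite qpoch_inf_euler by exact H.
refine (Cseries_scaled _ _ _ _ (euler_neq_0_disc q x H Hx) _ S); intros l.
rewrite (jackson_transformation q (A * q ^ l) D x (F l) H Hx); auto; [ring|].
apply Cmult_neq_0; [exact HA | now apply Cpow_nz, Cmod_gt_0].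
Qed.

Lemma humbert_heine (q A D x y : C) (c : nat -> C) :
  (0 < Cmod q < 1)%R -> (Cmod x < 1)%R -> (Cmod y < 1)%R ->
  (forall n, 1 - D * q ^ n <> 0) -> bounded c ->
  Csum2 (humbert_term q A D x y c) = 1 / (qpoch_inf D q * qpoch_inf x q) *
    Cseries (fun l => qpoch A q l * c l * y ^ l * heine q x D (x * (A * q ^ l))).
Proof.
intros [Q H] Hx Hy HD Hc.
destruct (humbert_rows q A D x y c H Hx Hy HD Hc) as [F [HF S]].
rewrite !qpoch_inf_euler by exact H.
refine (Cseries_scaled _ _ _ _ _ _ S).
- apply Cmult_neq_0; [now apply euler_neq_0 | now apply euler_neq_0_disc].
- intros l; rewrite <- (heine_transformation q (A * q ^ l) D x (F l)); auto; ring.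
Qed.

Lemma Cseries_eq (a b : nat -> C) : (forall l, a l = b l) -> Cseries a = Cseries b.
Proof.
intros H; f_equal; apply FunctionalExtensionality.functional_extensionality, H.
Qed.

(** * Complex powers and the final identities *)

Lemma Cexp_plus (z w : C) : Cexp (z + w) = Cexp z * Cexp w.
Proof.
unfold Cexp; change (Re (z + w)) with (Re z + Re w)%R.
change (Im (z + w)) with (Im z + Im w)%R; rewrite exp_plus, cos_plus, sin_plus.
apply injective_projections; simpl; ring.
Qed.

Lemma cpow_plus (lq a b : C) : cpow lq (a + b) = cpow lq a * cpow lq b.
Proof. unfold cpow; rewrite <- Cexp_plus; f_equal; ring. Qed.

Lemma cpow_0 (lq : C) : cpow lq 0 = 1.
Proof.
unfold cpow; rewrite Cmult_0_l; unfold Cexp; simpl.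
rewrite exp_0, cos_0, sin_0; apply injective_projections; simpl; ring.
Qed.

Lemma cpow_neq_0 (lq a : C) : cpow lq a <> 0.
Proof.
intros E; assert (K : cpow lq (a + - a) = 1)
  by (rewrite <- (cpow_0 lq); f_equal; ring).
rewrite cpow_plus, E, Cmult_0_l in K; injection K; lra.
Qed.

(** Here the chosen logarithm meets the base [q]; the other power rules follow from the exponential
    law for any [lq]. *)
Lemma cpow_INR (q lq : C) (n : nat) : Cexp lq = q -> cpow lq (INR n) = q ^ n.
Proof.
intros E; induction n as [|n IH]; [apply cpow_0|].
rewrite S_INR, RtoC_plus, cpow_plus, IH; unfold cpow; rewrite Cmult_1_l, E.
simpl; ring.
Qed.

Lemma cpow_opp (lq a : C) : cpow lq (- a) = / cpow lq a.
Proof.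
pose proof (cpow_neq_0 lq a) as N.
transitivity (cpow lq (a + - a) / cpow lq a).
- rewrite cpow_plus; now field.
- replace (a + - a) with (RtoC 0) by ring; rewrite cpow_0; now field.
Qed.

(** Turns the parameter conditions of the theorem into the form used by the product lemmas: no
    factor of (z; q)_k vanishes. *)
Lemma one_minus_mul_pow_neq_0 (q lq z : C) (n : nat) : Cexp lq = q ->
  z <> cpow lq (- INR n) -> 1 - z * q ^ n <> 0.
Proof.
intros E Hz K; apply Hz; rewrite cpow_opp, (cpow_INR q lq n E).
assert (N : q ^ n <> 0) by (rewrite <- (cpow_INR q lq n E); apply cpow_neq_0).
transitivity ((1 - (1 - z * q ^ n)) / q ^ n); [now field | rewrite K; now field].
Qed.

(** Both parts of the theorem are instances: [f] and [w] carry the double summand and the outer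
    coefficient in the shape of the statement, and pointwise equations tie them to the common
    form. *)
Lemma humbert_all (q lq a d x y : C) (c : nat -> C) (f : nat -> nat -> C)
    (w : nat -> C) :
  (0 < Cmod q < 1)%R -> Cexp lq = q -> (Cmod x < 1)%R -> (Cmod y < 1)%R ->
  (forall n : nat, cpow lq d <> cpow lq (- INR n)) -> bounded c ->
  (forall l k, f l k = humbert_term q (cpow lq a) (cpow lq d) x y c l k) ->
  (forall l, w l = qpoch (cpow lq a) q l * c l) ->
  (Csum2 f = 1 / qpoch_inf x q *
     Cseries (fun l => w l * y ^ l
       * phi11 (cpow lq (d - a - INR l)) (cpow lq d) q (x * cpow lq (a + INR l)))) /\
  ((forall l n : nat, x * cpow lq (a + INR l) <> cpow lq (- INR n)) ->
   Csum2 f = 1 / (qpoch_inf (cpow lq d) q * qpoch_inf x q) *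
     Cseries (fun l => w l * qpoch_inf (x * cpow lq (a + INR l)) q * y ^ l
       * phi11 x (x * cpow lq (a + INR l)) q (cpow lq d))) /\
  (Csum2 f = 1 / (qpoch_inf (cpow lq d) q * qpoch_inf x q) *
     Cseries (fun l => w l * y ^ l
       * Clim (fun z : C => qpoch_inf z q * phi11 x z q (cpow lq d))
              (locally' (T := C_UniformSpace) (x * cpow lq (a + INR l))))).
Proof.
intros Hq E Hx Hy Hd Hc Hf Hw.
assert (HD : forall n, 1 - cpow lq d * q ^ n <> 0)
  by (intros n; now apply (one_minus_mul_pow_neq_0 q lq)).
replace (Csum2 f) with (Csum2 (humbert_term q (cpow lq a) (cpow lq d) x y c)).
2: { f_equal; do 2 (apply FunctionalExtensionality.functional_extensionality; intro).
     symmetry; apply Hf. }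
assert (HA : forall l, cpow lq (a + INR l) = cpow lq a * q ^ l)
  by (intros l; now rewrite cpow_plus, (cpow_INR q lq l E)).
split; [|split; [intros Hp|]].
- rewrite humbert_phi11; auto using cpow_neq_0; f_equal; apply Cseries_eq; intros l.
  rewrite Hw, <- HA; do 2 f_equal.
  unfold Cdiv; rewrite <- cpow_opp, <- cpow_plus; f_equal; ring.
- rewrite humbert_heine; auto; f_equal; apply Cseries_eq; intros l.
  rewrite Hw, <- HA, <- phi11_heine, qpoch_inf_euler; [ring | apply Hq | apply Hq |].
  intros n; apply (one_minus_mul_pow_neq_0 q lq); auto.
- rewrite humbert_heine; auto; f_equal; apply Cseries_eq; intros l.
  now rewrite Hw, Clim_phi11_heine, HA.
Qed.

(** The second formula of each part is given in two readings: literally, when no x q^(a+l) is a pole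
    of 1phi1, and without that restriction, with (w; q)_oo 1phi1 (x; w; q, D) replaced by its limit
    at w = x q^(a+l). *)
Theorem theorem2p13 (q p lq lp x y : C)
    (hq : (0 < Cmod q < 1)%R) (hp : (0 < Cmod p < 1)%R)
    (hlq : Cexp lq = q) (hlp : Cexp lp = p)
    (hx : (Cmod x < 1)%R) (hy : (Cmod y < 1)%R) :
  (forall a b c d : C,
    (forall n : nat, cpow lp c <> cpow lp (- INR n)) ->
    (forall n : nat, cpow lq d <> cpow lq (- INR n)) ->
    (Psi1 (cpow lq a) (cpow lp b) (cpow lp c) (cpow lq d) q p x y =
       1 / qpoch_inf x q *
       Cseries (fun l =>
         qpoch (cpow lq a) q l * qpoch (cpow lp b) p l
         / (qpoch (cpow lp c) p l * qpoch p p l) * y ^ l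
         * phi11 (cpow lq (d - a - INR l)) (cpow lq d) q
                 (x * cpow lq (a + INR l))))
    /\
    ((forall l n : nat, x * cpow lq (a + INR l) <> cpow lq (- INR n)) ->
     Psi1 (cpow lq a) (cpow lp b) (cpow lp c) (cpow lq d) q p x y =
       1 / (qpoch_inf (cpow lq d) q * qpoch_inf x q) *
       Cseries (fun l =>
         qpoch (cpow lq a) q l * qpoch (cpow lp b) p l
         / (qpoch (cpow lp c) p l * qpoch p p l)
         * qpoch_inf (x * cpow lq (a + INR l)) q * y ^ l
         * phi11 x (x * cpow lq (a + INR l)) q (cpow lq d)))
    /\
    (Psi1 (cpow lq a) (cpow lp b) (cpow lp c) (cpow lq d) q p x y =
       1 / (qpoch_inf (cpow lq d) q * qpoch_inf x q) *
       Cseries (fun l =>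
         qpoch (cpow lq a) q l * qpoch (cpow lp b) p l
         / (qpoch (cpow lp c) p l * qpoch p p l) * y ^ l
         * Clim (fun w : C => qpoch_inf w q * phi11 x w q (cpow lq d))
                (locally' (T := C_UniformSpace) (x * cpow lq (a + INR l))))))
  /\
  (forall a b c : C,
    (forall n : nat, cpow lp b <> cpow lp (- INR n)) ->
    (forall n : nat, cpow lq c <> cpow lq (- INR n)) ->
    (Psi2 (cpow lq a) (cpow lp b) (cpow lq c) q p x y =
       1 / qpoch_inf x q *
       Cseries (fun l =>
         qpoch (cpow lq a) q l
         / (qpoch (cpow lp b) p l * qpoch p p l) * y ^ l
         * phi11 (cpow lq (c - a - INR l)) (cpow lq c) q
                 (x * cpow lq (a + INR l))))
    /\
    ((forall l n : nat, x * cpow lq (a + INR l) <> cpow lq (- INR n)) ->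
     Psi2 (cpow lq a) (cpow lp b) (cpow lq c) q p x y =
       1 / (qpoch_inf (cpow lq c) q * qpoch_inf x q) *
       Cseries (fun l =>
         qpoch (cpow lq a) q l
         / (qpoch (cpow lp b) p l * qpoch p p l)
         * qpoch_inf (x * cpow lq (a + INR l)) q * y ^ l
         * phi11 x (x * cpow lq (a + INR l)) q (cpow lq c)))
    /\
    (Psi2 (cpow lq a) (cpow lp b) (cpow lq c) q p x y =
       1 / (qpoch_inf (cpow lq c) q * qpoch_inf x q) *
       Cseries (fun l =>
         qpoch (cpow lq a) q l
         / (qpoch (cpow lp b) p l * qpoch p p l) * y ^ l
         * Clim (fun w : C => qpoch_inf w q * phi11 x w q (cpow lq c))
                (locally' (T := C_UniformSpace) (x * cpow lq (a + INR l)))))).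
Proof.
destruct hp as [hp0 hp1].
assert (Hinv : forall e, (forall n : nat, cpow lp e <> cpow lp (- INR n)) ->
  bounded (fun l => / qpoch (cpow lp e) p l * / qpoch p p l)
  /\ forall l, qpoch (cpow lp e) p l <> 0).
{ intros e He.
  assert (K : forall n, 1 - cpow lp e * p ^ n <> 0)
    by (intros n; now apply (one_minus_mul_pow_neq_0 p lp)).
  split; [|intros l; now apply qpoch_neq_0].
  apply bounded_mult; apply qpoch_inv_bounded; auto.
  intros n; now apply one_minus_qS_neq_0. }
assert (Np : forall l, qpoch p p l <> 0) by (intros l; now apply qpoch_qq_neq_0).
assert (Nq : forall l, qpoch q q l <> 0) by (intros l; now apply qpoch_qq_neq_0).
assert (Nd : forall d, (forall n : nat, cpow lq d <> cpow lq (- INR n)) ->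
  forall l, qpoch (cpow lq d) q l <> 0).
{ intros d Hd l; apply qpoch_neq_0; intros n.
  now apply (one_minus_mul_pow_neq_0 q lq). }
split.
- intros a b c d Hc Hd; destruct (Hinv c Hc) as [Bc Nc].
  (* [c] collects all base-p factors; the reciprocals stay separate, as [Hinv] bounds them in that
     form. *)
  apply (humbert_all q lq a d x y (fun l => qpoch (cpow lp b) p l
    * (/ qpoch (cpow lp c) p l * / qpoch p p l))); auto.
  + apply bounded_mult; [now apply qpoch_bounded | exact Bc].
  + intros l k; unfold humbert_term; specialize (Nd d Hd); field; auto.
  + intros l; field; auto.
- intros a b c Hb Hc; destruct (Hinv b Hb) as [Bb Nb].
  apply (humbert_all q lq a c x y (fun l => / qpoch (cpow lp b) p l * / qpoch p p l));
    auto.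
  + intros l k; unfold humbert_term; specialize (Nd c Hc); field; auto.
  + intros l; field; auto.
Qed.
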